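(* (1) $\mathfrak b_\sigma(\mathrm{Fin})=\mathfrak b_s(\mathrm{Fin})=\mathfrak b<\infty=\mathrm{add}_\omega(\mathrm{Fin})$. (2) $\mathfrak b_\sigma(\mathrm{Fin}\otimes\{\emptyset\})=\mathfrak b_s(\mathrm{Fin}\otimes\{\emptyset\})=\mathfrak b<\infty=\mathrm{add}_\omega(\mathrm{Fin}\otimes\{\emptyset\})$. (3) $\mathfrak b_\sigma(\mathcal I_d)=\mathrm{add}_\omega(\mathcal I_d)=\mathrm{add}(\mathcal N)\le\mathfrak b=\mathfrak b_s(\mathcal I_d)$. (4) $\mathfrak b_\sigma(\mathcal I_{1/n})=\mathrm{add}_\omega(\mathcal I_{1/n})=\mathrm{add}(\mathcal N)\le\mathfrak b=\mathfrak b_s(\mathcal I_{1/n})$. (5) $\mathfrak b_\sigma(\mathrm{Fin}\otimes\mathrm{Fin})=\mathfrak b_s(\mathrm{Fin}\otimes\mathrm{Fin})=\mathrm{add}_\omega(\mathrm{Fin}\otimes\mathrm{Fin})=\mathfrak b$. (6) $\mathfrak b_\sigma(\{\emptyset\}\otimes\mathrm{Fin})=\mathfrak b_s(\{\emptyset\}\otimes\mathrm{Fin})=\mathrm{add}_\omega(\{\emptyset\}\otimes\mathrm{Fin})=\mathfrak b$. (7) $\mathfrak b_\sigma(\mathcal S)=\mathfrak b_s(\mathcal S)=\mathrm{add}_\omega(\mathcal S)=\omega_1$.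
   Context: An ideal on a countably infinite set $S$ is a family of subsets of $S$ closed under finite unions and subsets, containing all finite sets, not containing $S$. Ideals: $\mathrm{Fin}$ = finite subsets of $\omega$; $\mathrm{Fin}\otimes\{\emptyset\}=\{A\subseteq\omega\times\omega:\{x:(A)_x\ne\emptyset\}\text{ finite}\}$; $\mathrm{Fin}\otimes\mathrm{Fin}=\{A\subseteq\omega\times\omega:\{x:(A)_x\text{ infinite}\}\text{ finite}\}$; $\{\emptyset\}\otimes\mathrm{Fin}=\{A\subseteq\omega\times\omega:(A)_x\text{ finite for all }x\}$, where $(A)_x=\{y:(x,y)\in A\}$; $\mathcal I_d=\{A\subseteq\omega:\lim_n|A\cap\{0,\dots,n-1\}|/(n+1)=0\}$; $\mathcal I_{1/n}=\{A\subseteq\omega:\sum_{n\in A}1/(n+1)<\infty\}$; Solecki's ideal $\mathcal S$: with $\Omega$ the countable set of clopen subsets of $2^\omega$ of Lebesgue measure $1/2$, $\mathcal S$ consists of subsets of $\Omega$ covered by finitely many sets $G_x=\{A\in\Omega:x\in A\}$, $x\in2^\omega$. $\mathfrak b$ is the least size of a subset of $\omega^\omega$ unbounded under $\le^*$ (eventual domination); $\mathrm{add}(\mathcal N)$ is the least size of a family of Lebesgue null subsets of $\mathbb R$ whose union is not null. Cardinals (convention $\min\emptyset=\infty$, $\kappa<\infty$ for every cardinal), for an ideal $\mathcal I$ on countably infinite $S$: $\widehat{\mathcal P}_{\mathcal I}$ = sequences $(A_n)_{n\in\omega}\in\mathcal I^\omega$ of pairwise disjoint sets; $\mathcal P_{\mathcal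 I}$ = those with $\bigcup_nA_n=S$; $\mathcal M_{\mathcal I}$ = sequences $(E_k)\in\mathcal I^\omega$ with $E_k\subseteq E_{k+1}$. $\mathfrak b_s(\mathcal I)=\min\{|\mathcal E|:\mathcal E\subseteq\widehat{\mathcal P}_{\mathcal I}$ and for every $(A_n)\in\mathcal P_{\mathcal I}$ there is $(E_n)\in\mathcal E$ with $\bigcup_n(A_{n+1}\cap\bigcup_{i\le n}E_i)\notin\mathcal I\}$; $\mathfrak b_\sigma(\mathcal I)=\min\{|\mathcal E|:\mathcal E\subseteq\mathcal M_{\mathcal I}$ and for every $(A_n)\in\mathcal M_{\mathcal I}$ there is $(E_n)\in\mathcal E$ with $E_n\not\subseteq A_n$ for infinitely many $n\}$; $\mathrm{add}_\omega(\mathcal I)=\min\{|\mathcal A|:\mathcal A\subseteq\mathcal I$ and for every $(B_n)\in\mathcal I^\omega$ there is $A\in\mathcal A$ with $A\not\subseteq B_n$ for all $n\}$. *)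

(* Defs.v *)
From HB Require Import structures.
From mathcomp Require Import all_boot all_order all_algebra.
From mathcomp Require Import all_classical all_reals all_analysis.
Set Implicit Arguments. Unset Strict Implicit. Unset Printing Implicit Defensive.
Import Order.TTheory GRing.Theory Num.Theory.
Import numFieldNormedType.Exports.
Local Open Scope classical_set_scope.
Local Open Scope ring_scope.

(* A cardinal invariant  min{|E| : P E}  (with min of the empty class = oo)
   is represented by the predicate P.  [mincard_le P Q] says
   min{|E| : P E} <= min{|F| : Q F}. *)
Definition mincard_le (X Y : Type) (P : set X -> Prop) (Q : set Y -> Prop) :=
  forall F : set Y, Q F -> exists2 E : set X, P E & (E #<= F)%card.
Definition mincard_eq (X Y : Type) (P : set X -> Prop) (Q : set Y -> Prop) :=
  mincard_le P Q /\ mincard_le Q P.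
Definition mincard_finite (X : Type) (P : set X -> Prop) := exists E, P E.
Definition mincard_infinite (X : Type) (P : set X -> Prop) := forall E, ~ P E.
Definition card_le_aleph1 (X : Type) (E : set X) :=
  exists lt : X -> X -> Prop,
    [/\ well_founded lt,
        (forall x, ~ lt x x),
        (forall x y z, lt x y -> lt y z -> lt x z),
        (forall x y, E x -> E y -> [\/ x = y, lt x y | lt y x]) &
        (forall y, E y -> countable [set x | E x /\ lt x y])].
Definition mincard_omega1 (X : Type) (P : set X -> Prop) :=
  (exists2 E, P E & card_le_aleph1 E) /\ (forall E, P E -> ~ countable E).

Section Invariants.
Variable T : Type.
Variable I : set (set T).

Definition hatP (A : nat -> set T) :=
  (forall n, I (A n)) /\ (forall n m, n <> m -> A n `&` A m = set0).
Definition partP (A : nat -> set T) :=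
  hatP A /\ \bigcup_n A n = [set: T].
Definition monM (E : nat -> set T) :=
  (forall n, I (E n)) /\ (forall n, E n `<=` E n.+1).

Definition bs_wit (EE : set (nat -> set T)) :=
  EE `<=` hatP /\
  forall A, partP A -> exists2 E, EE E &
    ~ I (\bigcup_n (A n.+1 `&` \bigcup_(i in [set i | (i <= n)%N]) E i)).
Definition bsigma_wit (EE : set (nat -> set T)) :=
  EE `<=` monM /\
  forall A, monM A -> exists2 E, EE E &
    infinite_set [set n | ~ (E n `<=` A n)].
Definition addw_wit (AA : set (set T)) :=
  AA `<=` I /\
  forall B : nat -> set T, (forall n, I (B n)) ->
    exists2 A, AA A & forall n, ~ (A `<=` B n).
End Invariants.

Definition le_star (f g : nat -> nat) := exists N, forall n, (N <= n)%N -> (f n <= g n)%N.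
Definition b_wit (F : set (nat -> nat)) := forall g, exists2 f, F f & ~ le_star f g.

Definition null_set (R : realType) (A : set R) :=
  (@lebesgue_measure R).-negligible A.
Definition addN_wit (R : realType) (F : set (set R)) :=
  F `<=` @null_set R /\ ~ null_set (\bigcup_(A in F) A).

Definition Fin : set (set nat) := [set A | finite_set A].
Definition section (A : set (nat * nat)) (x : nat) : set nat := [set y | A (x, y)].
Definition Fin_x_empty : set (set (nat * nat)) :=
  [set A | finite_set [set x | section A x !=set0]].
Definition Fin_x_Fin : set (set (nat * nat)) :=
  [set A | finite_set [set x | infinite_set (section A x)]].
Definition empty_x_Fin : set (set (nat * nat)) :=
  [set A | forall x, finite_set (section A x)].

Definition count_below (A : set nat) (n : nat) : nat := (\sum_(i < n) ((i : nat) \in A))%N.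
Definition I_d (R : realType) : set (set nat) :=
  [set A | (fun n : nat => (count_below A n)%:R / (n.+1)%:R : R) @ \oo --> (0:R)%R].
Definition I_1n (R : realType) : set (set nat) :=
  [set A | (\sum_(n <oo | n \in A) ((n.+1)%:R^-1 : R)%:E < +oo)%E].

(* Solecki's ideal.  2^omega = cantor_space (product topology on nat -> bool).
   The (coin-flipping) Lebesgue measure of a set A depending only on the first
   n coordinates is  #{s in 2^n : ext s in A} / 2^n. *)
Definition ext (n : nat) (s : n.-tuple bool) : cantor_space :=
  fun i => nth false s i.
Definition depends_on (A : set cantor_space) (n : nat) :=
  forall x y : cantor_space, (forall i, (i < n)%N -> x i = y i) -> A x -> A y.
Definition half_measure_clopen (A : set cantor_space) :=
  clopen A /\
  exists n, depends_on A n /\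
    ((#|[set s : n.-tuple bool | `[< A (ext s) >]]|%:R / (2 ^ n)%:R : rat) = 1 / 2).
Definition Omega := {A : set cantor_space | half_measure_clopen A}.
Definition G_x (x : cantor_space) : set Omega := [set A | proj1_sig A x].
Definition Solecki : set (set Omega) :=
  [set B | exists xs : seq cantor_space, B `<=` \bigcup_(x in [set x | x \in xs]) G_x x].

(* Main.v *)
(* The inequalities b_sigma <= b_s and b_sigma <= add_omega hold for every ideal
   considered here.  For the ideals built from Fin, increasing sequences of ideal
   sets are coded by single functions, so that b <= b_sigma, and from an unbounded
   family of functions one gets b_s-witnesses of the same size: the n-th set of
   the sequence given by f collects the blocks m with f (n-1) <= m < f n.

   For the density and summable ideals the link with add(N) goes through the
   summable ideals I_sum w = {A : sum_(i in A) w i < oo}.  A null set of reals is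
   contained in the limsup of the intervals I_i, i in D, for some D in I_sum w,
   where w i is about the length of I_i; hence add_omega (I_sum w) <= add(N).
   Conversely, if w i = 2^-(k i) and the U_i are independent sets of measure w i,
   then D |-> limsup_(i in D) U_i maps I_sum w to null sets; if the union of these
   limsups is null, cover it by an open set O of measure less than 1.  A Baire
   category argument in the complement of O gives, for each D, a dyadic interval
   J not almost contained in O such that almost all i in D belong to
   {i : J `&` U_i is almost contained in O}, and by independence these countably
   many sets belong to I_sum w; hence add(N) <= add_omega (I_sum w).  Coding
   finite pieces of sets by integers, and using families of independent subsets
   of the blocks [2^m, 2^(m+1)), transfers add_omega between I_sum w and any
   ideal lying between I_1n and I_d, the pieces being made bounded by means of
   add_omega <= b.

   For Solecki's ideal, any uncountable family of sets G_x is a witness, since a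
   countable union of finite sets of points x misses some of them; by the
   well-ordering theorem it may be taken of size aleph_1. *)
Require Import Defs.
From HB Require Import structures.
From mathcomp Require Import all_boot all_order all_algebra.
From mathcomp Require Import all_classical all_reals all_analysis.
From mathcomp Require Import zify lra.
Set Implicit Arguments. Unset Strict Implicit. Unset Printing Implicit Defensive.
Import Order.TTheory GRing.Theory Num.Theory.
Import numFieldNormedType.Exports.
Local Open Scope classical_set_scope.

(** * Cardinal invariants of arbitrary ideals *)

Lemma ex_choice (X Y : Type) (P : X -> Y -> Prop) :
  (forall x, exists y, P x y) -> exists f : X -> Y, forall x, P x (f x).
Proof. by move=> /choice[f fP]; exists f. Qed.

Lemma choice_on (X Y : Type) (y0 : Y) (A : set X) (P : X -> Y -> Prop) :
  (forall x, A x -> exists y, P x y) ->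
  exists f : X -> Y, forall x, A x -> P x (f x).
Proof.
move=> AP; apply: (@ex_choice X Y (fun x y => A x -> P x y)) => x.
have [Ax|nAx] := pselect (A x); last by exists y0.
by have [y Pxy] := AP x Ax; exists y.
Qed.

(** An image is never larger than its source, so a map carrying witnesses to witnesses compares two
    invariants. The map may depend on the family [F]. *)
Lemma mincard_le_image (X Y : Type) (P : set X -> Prop) (Q : set Y -> Prop) :
  (forall F, Q F -> exists f : Y -> X, P (f @` F)) -> mincard_le P Q.
Proof.
by move=> PQ F /PQ[f Pf]; exists (f @` F) => //; exact: card_image_le.
Qed.

Lemma mincard_le_trans (X Y Z : Type) (P : set X -> Prop) (Q : set Y -> Prop)
    (S : set Z -> Prop) :
  mincard_le P Q -> mincard_le Q S -> mincard_le P S.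
Proof.
move=> PQ QS F /QS[E /PQ[D PD DE] EF]; exists D => //.
exact: card_le_trans DE EF.
Qed.

Lemma infinite_natP (A : set nat) :
  infinite_set A <-> forall N, exists2 n, (N <= n)%N & A n.
Proof.
split=> [Ainf N|AN].
  apply: contrapT => noN; apply: Ainf.
  apply: (sub_finite_set _ (finite_II N)) => n An /=.
  by rewrite ltnNge; apply/negP => Nn; apply: noN; exists n.
move=> Afin.
have [s AE] := (finite_seqP A).1 Afin.
have [n Nn] := AN (\max_(i <- s) i).+1%N.
rewrite AE /= => ns; move: Nn; rewrite ltnNge => /negP; apply.
exact: (@leq_bigmax_seq _ _ predT id).
Qed.

Lemma finite_natP (A : set nat) :
  finite_set A <-> exists N, forall n, A n -> (n < N)%N.
Proof.
split=> [Afin|[N AltN]].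
  apply: contrapT => noN; apply/infinite_natP: Afin => N.
  apply: contrapT => NN; apply: noN; exists N => n An.
  by rewrite ltnNge; apply/negP => Nn; apply: NN; exists n.
exact: (sub_finite_set _ (finite_II N)).
Qed.

Definition is_ideal (T : Type) (I : set (set T)) :=
  [/\ I set0, (forall A B, A `<=` B -> I B -> I A) &
      forall A B, I A -> I B -> I (A `|` B)].

Lemma ideal_bigcup_leq (T : Type) (I : set (set T)) (A : nat -> set T) n :
  is_ideal I -> (forall i, I (A i)) ->
  I (\bigcup_(i in [set i | (i <= n)%N]) A i).
Proof.
move=> [I0 IS IU] IA.
have -> : \bigcup_(i in [set i | (i <= n)%N]) A i = \bigcup_(i < n.+1) A i.
  by [].
rewrite bigcup_mkord; elim: n.+1 => [|m IHm]; first by rewrite big_ord0.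
by rewrite big_ord_recr /=; exact: IU.
Qed.

Lemma bigcup_leqS (T : Type) (A : nat -> set T) m n : (m <= n)%N ->
  \bigcup_(i in [set i | (i <= m)%N]) A i
    `<=` \bigcup_(i in [set i | (i <= n)%N]) A i.
Proof. by move=> mn x [i /= im Aix]; exists i => //=; exact: leq_trans im mn. Qed.

Lemma monM_leq (T : Type) (I : set (set T)) (E : nat -> set T) m n :
  monM I E -> (m <= n)%N -> E m `<=` E n.
Proof.
move=> [_ ES]; elim: n => [|n IHn]; first by rewrite leqn0 => /eqP ->.
rewrite leq_eqVlt => /orP[/eqP ->//|]; rewrite ltnS => /IHn; move/subset_trans.
by apply.
Qed.

Lemma monM_bigcup_leq (T : Type) (I : set (set T)) (E : nat -> set T) :
  is_ideal I -> (forall n, I (E n)) ->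
  monM I (fun n => \bigcup_(i in [set i | (i <= n)%N]) E i).
Proof.
move=> idI IE; split=> n; first exact: ideal_bigcup_leq.
exact: bigcup_leqS.
Qed.

(* The differences of an increasing sequence [A] exhausting [T] form a
   partition, and once [A] dominates [E] it sends [E] into finitely many
   pieces. *)
Lemma bsigma_le_bs (T : Type) (I : set (set T)) (s : nat -> set T) :
  is_ideal I -> (forall n, I (s n)) -> \bigcup_n s n = setT ->
  mincard_le (bsigma_wit I) (bs_wit I).
Proof.
move=> idI Is sT; have [I0 IS IU] := idI.
apply: mincard_le_image => EE [hatEE bsEE].
exists (fun E n => \bigcup_(i in [set i | (i <= n)%N]) E i); split.
  move=> _ [E /hatEE[IE _] <-]; exact: monM_bigcup_leq.
move=> A [IA AS]; apply: contrapT => noE.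
(* Adjoining [s 0, ..., s n] makes the increasing sequence exhaust [T], as its differences have to
   form a partition. *)
pose A' n := A n `|` \bigcup_(i in [set i | (i <= n)%N]) s i.
have IA' n : I (A' n) by apply: IU => //; exact: ideal_bigcup_leq.
have A'S n : A' n `<=` A' n.+1 by apply: setUSS => //; exact: bigcup_leqS.
have A'le m n : (m <= n)%N -> A' m `<=` A' n by exact: (@monM_leq _ I).
pose B n := if n is m.+1 then A' m.+1 `\` A' m else A' 0%N.
have BA' n : B n `<=` A' n by case: n => [//|n]; exact: subDsetl.
have Bdisj m n : (m < n)%N -> B m `&` B n = set0.
  case: n => // n; rewrite ltnS => mn.
  rewrite -subset0 => x [/BA' A'mx [_]]; apply; exact: A'le A'mx.
have /bsEE[E EE_E] : partP I B.
  split; first split.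
  - by move=> n; apply: IS (BA' n) (IA' n).
  - move=> m n /eqP; rewrite neq_ltn => /orP[]; first exact: Bdisj.
    by rewrite setIC; exact: Bdisj.
  - rewrite -subTset => x _.
    have [k [_ A'kx]] : exists k, True /\ A' k x.
      have : [set: T] x by []. rewrite -sT => -[k _ skx]; exists k; split => //.
      by right; exists k => /=.
    elim: k A'kx => [|k IHk] A'kx; first by exists 0%N.
    have [/IHk//|nA'kx] := pselect (A' k x); by exists k.+1.
apply.
have [N EN] : exists N, forall n, (N <= n)%N ->
    \bigcup_(i in [set i | (i <= n)%N]) E i `<=` A n.
  apply: contrapT => noN; apply: noE; eexists; first by exists E.
  apply/infinite_natP => N; apply: contrapT => nn; apply: noN; exists N => n Nn.
  by apply: contrapT => ?; apply: nn; exists n.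
(* For [n >= N] the points of [E 0, ..., E n] already lie in [A n], so only stages before [N]
   contribute, and their contribution lies in [A N]. *)
apply: IS (IA' N) => x [n _ [[_ nA'nx] Ex]].
have [Nn|nN] := leqP N n; first by case: nA'nx; left; exact: EN Ex.
case: (@monM_bigcup_leq _ I E idI) => [n'|_ _]; first by case: (hatEE E EE_E).
left; apply: (EN N (leqnn N)); exact: bigcup_leqS (ltnW nN) _ Ex.
Qed.

(** Constant sequences do it: an increasing sequence none of whose terms contains [A] fails to
    contain it at every stage, hence infinitely often. *)
Lemma bsigma_le_addw (T : Type) (I : set (set T)) :
  mincard_le (bsigma_wit I) (addw_wit I).
Proof.
apply: mincard_le_image => AA [AAI addAA]; exists (fun A _ => A); split.
  by move=> _ [A /AAI IA <-]; split=> // n x.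
move=> B [IB _]; have [A AA_A nAB] := addAA B IB.
exists (fun=> A); first by exists A.
by apply/infinite_natP => N; exists N => //; exact: nAB.
Qed.

(** * Unbounded families of functions *)

(** Summing [(g i).+1] over [i <= n] makes a bound [g] strictly increasing and the eventual
    domination strict. *)
Lemma dominating_increasing (F : set (nat -> nat)) :
  ~ b_wit F ->
  exists g : nat -> nat, {homo g : m n / (m < n)%N} /\
    forall f, F f -> exists N, forall n, (N <= n)%N -> (f n < g n)%N.
Proof.
move=> /existsNP[g ndom]; exists (fun n => \sum_(i < n.+1) (g i).+1)%N; split.
  apply: homo_ltn => [? ? ?|n]; first exact: ltn_trans.
  by rewrite [ltnRHS]big_ord_recr /=; lia.
move=> f Ff; have [N fg] : le_star f g.
  by apply: contrapT => nfg; apply: ndom; exists f.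
exists N => n /fg fgn; rewrite big_ord_recr /=; lia.
Qed.

Lemma increasing_leq (g : nat -> nat) m n :
  {homo g : m n / (m < n)%N} -> (m <= n)%N -> (g m <= g n)%N.
Proof. by move=> gS; rewrite leq_eqVlt => /orP[/eqP ->//|/gS /ltnW]. Qed.

Lemma increasing_ge_id (g : nat -> nat) n :
  {homo g : m n / (m < n)%N} -> (n <= g n)%N.
Proof. by move=> gS; elim: n => // n IHn; apply: leq_ltn_trans IHn (gS _ _ _). Qed.

Lemma mincard_finite_b : mincard_finite b_wit.
Proof.
exists setT => g; exists (fun n => (g n).+1) => // -[N /(_ N (leqnn N))].
by rewrite ltnn.
Qed.

(* [E i] collects the blocks [P m] with [f j <= m < f i] for all [j < i]: if
   [f n] exceeds the point [h n] after which [A 0, ..., A n] miss most of each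
   block, the bad set contains most of the block [P (f n).-1]. *)
Lemma bs_le_b (T : Type) (I : set (set T)) (P : nat -> set T)
    (Q : nat -> set T -> Prop) :
  is_ideal I -> (forall m, I (P m)) ->
  (forall m n, m <> n -> P m `&` P n = set0) ->
  (forall m A B, A `<=` B -> Q m A -> Q m B) ->
  (forall B, I B -> exists N, forall m, (N <= m)%N -> Q m (P m `\` B)) ->
  (forall B, I B -> ~ (forall N, exists2 m, (N <= m)%N & Q m B)) ->
  mincard_le (bs_wit I) b_wit.
Proof.
move=> idI IP Pdisj Qmon Qbig Qsmall; have [I0 IS IU] := idI.
apply: mincard_le_image => F Fb.
(* [e f i m] says that [i] is the first index with [m < f i], so each block enters at most one
   piece. *)
pose e (f : nat -> nat) i m := (m < f i)%N /\ forall j, (j < i)%N -> (f j <= m)%N.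
pose E f i := \bigcup_(m in [set m | e f i m]) P m.
have e_le f n m : (m < f n)%N -> exists2 i, (i <= n)%N & e f i m.
  move=> mf; have [i mfi min_i] := @ex_minnP (fun i => m < f i)%N (ex_intro _ n mf).
  exists i; first exact: min_i.
  by split => // j ji; rewrite leqNgt; apply/negP => /min_i; rewrite leqNgt ji.
exists E; split.
  move=> _ [f _ <-]; split=> [i|i j ij].
    apply: IS (@ideal_bigcup_leq _ _ P (f i) idI IP) => x [m [mf _] Px].
    by exists m => //=; exact: ltnW.
  rewrite -subset0 => x [[m em Pmx] [m' em' Pm'x]].
  have [mm'|/eqP/Pdisj mm'] := eqVneq m m'; last by rewrite -mm'; split.
  move: em em' => [mi mi'] [mj mj']; rewrite -{m'}mm' in mj mj' {Pm'x}.
  move: ij => /eqP; rewrite neq_ltn => /orP[/mj'|/mi']; lia.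
move=> A [[IA Adisj] Acov].
have [h hP] := ex_choice (fun n => Qbig _ (ideal_bigcup_leq n idI IA)).
(* The summand [n] pushes the block index [(f n).-1] beyond any prescribed [N]. *)
have [f Ff nfh] := Fb (fun n => h n + n)%N.
exists (E f); first by exists f.
move=> Ibad; apply: (Qsmall _ Ibad) => N.
have [n Nn fn] : exists2 n, (N <= n)%N & (h n + n < f n)%N.
  apply: contrapT => nn; apply: nfh; exists N => n Nn.
  by rewrite leqNgt; apply/negP => ?; apply: nn; exists n.
exists (f n).-1%N; first lia.
apply: Qmon (hP n (f n).-1%N _); last lia.
have [i ilen ei] : exists2 i, (i <= n)%N & e f i (f n).-1%N by apply: e_le; lia.
(* A point of the block outside [A 0, ..., A n] lies in some [A k.+1] with [k >= n], and its piece
   has index [i <= n <= k], so it enters the bad set. *)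
move=> x [Px nAx].
have : [set: T] x by [].
rewrite -Acov => -[[|k] _ Akx]; first by case: nAx; exists 0%N.
have nk : (n <= k)%N.
  by rewrite leqNgt; apply/negP => kn; apply: nAx; exists k.+1.
exists k => //; split => //; exists i => /=; first exact: leq_trans nk.
by exists (f n).-1%N.
Qed.

(** * Ideals built from finite sets *)

Lemma Fin_ideal : is_ideal Fin.
Proof.
split=> [|A B|A B]; rewrite /Fin /=; first exact: finite_set0.
  exact: sub_finite_set.
by move=> ? ?; rewrite finite_setU.
Qed.

Lemma Fin_x_empty_ideal : is_ideal Fin_x_empty.
Proof.
split=> [|A B AB|A B fA fB] /=.
- by apply: sub_finite_set (@finite_set0 nat) => x [].
- by apply: sub_finite_set => x [y Axy]; exists y; exact: AB.
- apply: (@sub_finite_set _ _ ([set x | section A x !=set0] `|`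
    [set x | section B x !=set0])); last by rewrite finite_setU.
  by move=> x [y [Axy|Bxy]]; [left|right]; exists y.
Qed.

Lemma Fin_x_Fin_ideal : is_ideal Fin_x_Fin.
Proof.
split=> [|A B AB|A B fA fB] /=.
- by apply: sub_finite_set (@finite_set0 nat) => x; apply; exact: finite_set0.
- apply: sub_finite_set => x /=; apply: contra_not; apply: sub_finite_set.
  by move=> y; exact: AB.
- apply: (@sub_finite_set _ _ ([set x | infinite_set (section A x)] `|`
    [set x | infinite_set (section B x)])); last by rewrite finite_setU.
  move=> x /= infU; have [finA|] := pselect (finite_set (section A x)); last by left.
  right => finB; apply: infU.
  apply: (@sub_finite_set _ _ (section A x `|` section B x)) => //.
  by rewrite finite_setU.
Qed.

Lemma empty_x_Fin_ideal : is_ideal empty_x_Fin.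
Proof.
split=> [x|A B AB IB x|A B IA IB x] /=; first exact: finite_set0.
  by apply: sub_finite_set (IB x) => y; exact: AB.
apply: (@sub_finite_set _ _ (section A x `|` section B x)) => //.
by rewrite finite_setU.
Qed.

Lemma empty_x_Fin_sub : empty_x_Fin `<=` Fin_x_Fin.
Proof.
move=> A IA; apply: sub_finite_set (@finite_set0 nat) => x /=; apply.
exact: IA.
Qed.

(** Membership is recast as a cover by finitely many columns and the region below a graph, the form
    in which these sets are coded by functions. *)
Lemma Fin_x_FinP (A : set (nat * nat)) : Fin_x_Fin A <->
  exists N (phi : nat -> nat), forall x y, A (x, y) -> (x < N)%N \/ (y < phi x)%N.
Proof.
split=> [/finite_natP[N AN]|[N [phi Aphi]]].
  exists N.
  have secA x : (N <= x)%N -> exists c, forall y, section A x y -> (y < c)%N.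
    by move=> Nx; apply/finite_natP; apply: contrapT => /AN; rewrite ltnNge Nx.
  have [phi phiP] := choice_on 0%N secA.
  exists phi => x y Axy; have [Nx|] := leqP N x; last by left.
  by right; exact: phiP.
apply/finite_natP; exists N => x; apply: contra_notT; rewrite -leqNgt => Nx.
apply/finite_natP; exists (phi x) => y /Aphi[|//]; lia.
Qed.

Lemma bs_le_b_Fin : mincard_le (bs_wit Fin) b_wit.
Proof.
apply: (@bs_le_b _ _ (fun m => [set m]) (fun m A => A m)) => //.
- exact: Fin_ideal.
- by move=> m; exact: finite_set1.
- by move=> m n mn; rewrite -subset0 => x [/= -> /mn].
- move=> m A B AB; exact: AB.
- by move=> B /finite_natP[N BN]; exists N => m Nm; split => // /BN; lia.
- by move=> B /finite_natP[N BN] /(_ N)[m Nm /BN]; lia.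
Qed.

Lemma bs_le_b_Fin_x_empty : mincard_le (bs_wit Fin_x_empty) b_wit.
Proof.
apply: (@bs_le_b _ _ (fun m => [set (m, 0%N)]) (fun m A => A (m, 0%N))) => //.
- exact: Fin_x_empty_ideal.
- by move=> m; apply/finite_natP; exists m.+1 => n [y [-> _]].
- by move=> m n mn; rewrite -subset0 => x [/= -> [/mn]].
- move=> m A B AB; exact: AB.
- move=> B /finite_natP[N BN]; exists N => m Nm; split => // Bm.
  have /BN : [set x | section B x !=set0] m by exists 0%N.
  lia.
- move=> B /finite_natP[N BN] /(_ N)[m Nm Bm].
  have /BN : [set x | section B x !=set0] m by exists 0%N.
  lia.
Qed.

Lemma bs_le_b_empty_x_Fin : mincard_le (bs_wit empty_x_Fin) b_wit.
Proof.
apply: (@bs_le_b _ _ (fun m => [set (0%N, m)]) (fun m A => A (0%N, m))) => //.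
- exact: empty_x_Fin_ideal.
- by move=> m x; apply/finite_natP; exists m.+1 => n [_ ->].
- by move=> m n mn; rewrite -subset0 => x [/= -> [/mn]].
- move=> m A B AB; exact: AB.
- move=> B /(_ 0%N)/finite_natP[N BN]; exists N => m Nm; split => // /BN; lia.
- by move=> B /(_ 0%N)/finite_natP[N BN] /(_ N)[m Nm /BN]; lia.
Qed.

(** The blocks are whole columns, and a column counts as large when its section is infinite: a set
    of the ideal takes only finitely many points from almost every column. *)
Lemma bs_le_b_Fin_x_Fin : mincard_le (bs_wit Fin_x_Fin) b_wit.
Proof.
apply: (@bs_le_b _ _ (fun m => [set xy | xy.1 = m])
  (fun m A => infinite_set (section A m))) => //.
- exact: Fin_x_Fin_ideal.
- move=> m; apply/Fin_x_FinP; exists m.+1, (fun=> 0%N) => x y /= ->; left.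
  exact: ltnSn.
- by move=> m n mn; rewrite -subset0 => x [/= -> /mn].
- move=> m A B AB; apply: contra_not; apply: sub_finite_set => y; exact: AB.
- move=> B /finite_natP[N BN]; exists N => m Nm.
  have finB : finite_set (section B m) by apply: contrapT => /BN; lia.
  move=> finD; apply: infinite_nat.
  apply: (@sub_finite_set _ _ (section B m `|`
    section ([set xy | xy.1 = m] `\` B) m)); last by rewrite finite_setU.
  by move=> y _; have [By|nBy] := pselect (section B m y); [left|right].
- by move=> B /finite_natP[N BN] /(_ N)[m Nm /BN]; lia.
Qed.

(** * Coding increasing sequences by functions *)

Lemma bigmax_ord_sup (F : nat -> nat) n i : (i < n)%N -> (F i <= \max_(j < n) F j)%N.
Proof. by move=> i_n; exact: (@leq_bigmax _ (fun j : 'I_n => F j) (Ordinal i_n)). Qed.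

(** The codes of a witness cannot be bounded: a strictly increasing bound [g] would give a sequence
    [A g] that contains every member of the family from some stage on. *)
Lemma b_le_bsigma_code (T : Type) (I : set (set T))
    (code : (nat -> set T) -> nat -> nat) (A : (nat -> nat) -> nat -> set T) :
  (forall g, {homo g : m n / (m < n)%N} -> monM I (A g)) ->
  (forall E g N, {homo g : m n / (m < n)%N} -> monM I E ->
     (forall n, (N <= n)%N -> (code E n < g n)%N) ->
     forall n, (N <= n)%N -> E n `<=` A g n) ->
  mincard_le b_wit (bsigma_wit I).
Proof.
move=> monA domA; apply: mincard_le_image => EE [EEmon bEE]; exists code.
apply: contrapT => /dominating_increasing[g [gS gdom]].
have [E EE_E] := bEE _ (monA g gS).
have [N EN] : exists N, forall n, (N <= n)%N -> (code E n < g n)%N.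
  by apply: gdom; exists E.
move=> /infinite_natP/(_ N)[n Nn]; apply; apply: (domA _ _ N) => //.
exact: EEmon.
Qed.

Lemma b_le_bsigma_Fin : mincard_le b_wit (bsigma_wit Fin).
Proof.
have [code codeP] := @choice_on (nat -> set nat) _ (fun=> 0%N) (monM Fin)
  (fun E c => forall n x, E n x -> (x < c n)%N)
  (fun E monE => ex_choice (fun n => (finite_natP (E n)).1 (monE.1 n))).
apply: (@b_le_bsigma_code _ _ code (fun g n => [set x | (x < g n)%N])).
- move=> g gS; split=> n; first exact: finite_II.
  by move=> x /= xg; apply: ltn_trans xg (gS _ _ _).
- by move=> E g N _ monE dom n Nn x Ex /=; apply: ltn_trans (codeP _ _ _ _ Ex) (dom _ _).
Qed.

Lemma b_le_bsigma_Fin_x_empty : mincard_le b_wit (bsigma_wit Fin_x_empty).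
Proof.
have [code codeP] := @choice_on (nat -> set (nat * nat)) _ (fun=> 0%N)
  (monM Fin_x_empty) (fun E c => forall n x, section (E n) x !=set0 -> (x < c n)%N)
  (fun E monE => ex_choice (fun n => (finite_natP _).1 (monE.1 n))).
apply: (@b_le_bsigma_code _ _ code (fun g n => [set x | (x.1 < g n)%N])).
- move=> g gS; split=> n; first by apply/finite_natP; exists (g n) => x [].
  by move=> x /= xg; apply: ltn_trans xg (gS _ _ _).
- move=> E g N _ monE dom n Nn [x y] Exy /=.
  by apply: ltn_trans (codeP _ monE n x _) (dom _ Nn); exists y.
Qed.

(** The code at [k] bounds the heights in all columns up to [k] at all stages up to [k]. Allowing
    height [g (maxn n x)] in column [x] uses the domination only at arguments beyond [n]. *)
Lemma b_le_bsigma_empty_x_Fin : mincard_le b_wit (bsigma_wit empty_x_Fin).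
Proof.
have [phi phiP] := @choice_on (nat -> set (nat * nat)) _ (fun=> fun=> 0%N)
  (monM empty_x_Fin) (fun E c => forall n x y, E n (x, y) -> (y < c n x)%N)
  (fun E monE => ex_choice (fun n => ex_choice (fun x => (finite_natP _).1 (monE.1 n x)))).
apply: (@b_le_bsigma_code _ _
  (fun E n => \max_(i < n.+1) \max_(x < n.+1) phi E i x)%N
  (fun g n => [set xy | (xy.2 < g (maxn n xy.1))%N])).
- move=> g gS; split=> [n x|n].
    by apply/finite_natP; exists (g (maxn n x)).
  by move=> xy /= /leq_trans; apply; apply: increasing_leq => //; lia.
- move=> E g N gS monE dom n Nn [x y] /(phiP _ monE) /= yphi.
  have := dom (maxn n x) ltac:(lia).
  have : (phi E n x <= \max_(i < (maxn n x).+1) \max_(x0 < (maxn n x).+1) phi E i x0)%N.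
    apply: leq_trans (@bigmax_ord_sup (phi E n) (maxn n x).+1 x _) _; first lia.
    apply: (@bigmax_ord_sup (fun i => \max_(x0 < (maxn n x).+1) phi E i x0)%N).
    lia.
  lia.
Qed.

Lemma b_le_bsigma_Fin_x_Fin : mincard_le b_wit (bsigma_wit Fin_x_Fin).
Proof.
have code_ex E : monM Fin_x_Fin E -> exists c : nat -> nat,
    forall n x y, E n (x, y) -> (x < c n)%N \/ (n <= x)%N /\ (y < c x)%N.
  move=> [IE _].
  have [N NP] := ex_choice (fun n => (Fin_x_FinP _).1 (IE n)).
  have [phi phiP] := ex_choice NP.
  (* At stage [n] the columns before [n] or before [N n] are absorbed by [x < c n]; in a column
     [x >= n] the maximum in [c x] runs over all stages up to [x], hence includes stage [n]. *)
  exists (fun n => n + N n + \max_(i < n.+1) phi i n)%N => n x y /phiP[xN|yphi].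
    by left; lia.
  have [nx|xn] := leqP n x; last by left; lia.
  right; split=> //.
  have := @bigmax_ord_sup (fun i => phi i x) x.+1 n ltac:(lia).
  lia.
have [code codeP] := choice_on (fun=> 0%N) code_ex.
apply: (@b_le_bsigma_code _ _ code
  (fun g n => [set xy | (xy.1 < g n)%N \/ (xy.2 < g xy.1)%N])).
- move=> g gS; split=> n; first by apply/Fin_x_FinP; exists (g n), g.
  by move=> xy /= [xg|]; [left; apply: ltn_trans xg (gS _ _ _)|right].
- move=> E g N gS monE dom n Nn [x y] /(codeP _ monE)[xc|[nx yc]] /=.
    by left; exact: ltn_trans (dom _ Nn).
  by right; apply: ltn_trans yc (dom _ _); exact: leq_trans nx.
Qed.

(** Subgraphs serve as witnesses: one contained in [B n] forces [f] below [phi n] from [N n] on,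
    hence eventually below the diagonal maximum of all the [phi i]. *)
Lemma addw_le_b_subgraph (I : set (set (nat * nat))) :
  empty_x_Fin `<=` I -> I `<=` Fin_x_Fin -> mincard_le (addw_wit I) b_wit.
Proof.
move=> subI Isub; apply: mincard_le_image => F Fb.
exists (fun f => [set xy | (xy.2 <= f xy.1)%N]); split.
  by move=> _ [f _ <-]; apply: subI => x; apply/finite_natP; exists (f x).+1.
move=> B IB.
have [N NP] := ex_choice (fun n => (Fin_x_FinP _).1 (Isub _ (IB n))).
have [phi phiP] := ex_choice NP.
have [f Ff nfg] := Fb (fun n => \max_(i < n.+1) phi i n)%N.
eexists; first by exists f.
move=> n AB; apply: nfg; exists (N n + n)%N => x Nx.
have /AB/phiP : [set xy | (xy.2 <= f xy.1)%N] (x, f x) by exact: leqnn.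
have := @bigmax_ord_sup (fun i => phi i x) x.+1 n ltac:(lia).
lia.
Qed.

(** The initial segments are a countable cofinal family of the ideal, so no family of its sets
    escapes all of them. *)
Lemma addw_Fin_infinite : mincard_infinite (addw_wit Fin).
Proof.
move=> AA [AAF /(_ (fun n => [set k | (k < n)%N]))[n|A /AAF/finite_natP[N AN]]].
  exact: finite_II.
by move=> /(_ N); apply.
Qed.

Lemma addw_Fin_x_empty_infinite : mincard_infinite (addw_wit Fin_x_empty).
Proof.
move=> AA [AAF /(_ (fun n => [set x | (x.1 < n)%N]))[n|A /AAF/finite_natP[N AN]]].
  by apply/finite_natP; exists n => x [].
by move=> /(_ N); apply => -[x y] Axy; apply: AN; exists y.
Qed.

Lemma bsigma_le_bs_pairs (I : set (set (nat * nat))) :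
  is_ideal I -> (forall x y, I [set (x, y)]) ->
  mincard_le (bsigma_wit I) (bs_wit I).
Proof.
move=> idI I1; have [I0 _ _] := idI.
apply: (@bsigma_le_bs _ I (fun n => [set xy | pickle xy = n])) => //.
- move=> n; have [[[x y] xyn]|nn] := pselect (exists xy : nat * nat, pickle xy = n).
    have -> : [set xy : nat * nat | pickle xy = n] = [set (x, y)] => //.
    apply/seteqP; split => [xy /=|_ -> //]; rewrite -xyn.
    exact: (pcan_inj pickleK).
  rewrite (_ : [set _ | _] = set0) // -subset0 => xy xyn.
  by apply: nn; exists xy.
- by rewrite -subTset => xy _; exists (pickle xy).
Qed.

Lemma Fin_part :
  [/\ mincard_eq (bsigma_wit Fin) b_wit & mincard_eq (bs_wit Fin) b_wit].
Proof.
have bsbs : mincard_le (bsigma_wit Fin) (bs_wit Fin).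
  apply: (@bsigma_le_bs _ Fin (fun n => [set n])) => //; first exact: Fin_ideal.
    by move=> n; exact: finite_set1.
  by rewrite -subTset => n _; exists n.
split; split; first exact: mincard_le_trans bsbs bs_le_b_Fin.
- exact: b_le_bsigma_Fin.
- exact: bs_le_b_Fin.
- exact: mincard_le_trans b_le_bsigma_Fin bsbs.
Qed.

Lemma pairs_part (I : set (set (nat * nat))) :
  is_ideal I -> (forall x y, I [set (x, y)]) ->
  mincard_le b_wit (bsigma_wit I) -> mincard_le (bs_wit I) b_wit ->
  mincard_eq (bsigma_wit I) b_wit /\ mincard_eq (bs_wit I) b_wit.
Proof.
move=> idI I1 bbs bsb; have bsbs := bsigma_le_bs_pairs idI I1.
by split; split => //; [exact: mincard_le_trans bsb|exact: mincard_le_trans bsbs].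
Qed.

Lemma empty_x_Fin1 x y : empty_x_Fin [set (x, y)].
Proof. by move=> x'; apply/finite_natP; exists y.+1 => _ [_ ->]. Qed.

Lemma Fin_x_empty1 x y : Fin_x_empty [set (x, y)].
Proof. by apply/finite_natP; exists x.+1 => _ [_ [-> _]]. Qed.

(** * Solecki's ideal *)

(** A countable family is dominated by a diagonal sequence, whose [n]-th term unites the [n]-th
    terms of the members numbered at most [n]. *)
Lemma bsigma_not_countable (T : Type) (I : set (set T)) EE :
  is_ideal I -> bsigma_wit I EE -> ~ countable EE.
Proof.
move=> idI [monEE bEE] /countable_injP[f]; have [I0 IS IU] := idI.
move=> f_inj.
pose X m n := [set x | exists E, [/\ EE E, f E = m & E n x]].
have IX n m : I (X m n).
  have [[E [EE_E fE]]|nE] := pselect (exists E, EE E /\ f E = m).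
    apply: IS ((monEE E EE_E).1 n) => x [E' [EE_E' fE' E'x]].
    by rewrite (f_inj E E') ?inE// fE fE'.
  by apply: IS I0 => x [E [EE_E fE _]]; apply: nE; exists E.
have [|E EE_E] := bEE (fun n => \bigcup_(m in [set m | (m <= n)%N]) X m n).
  split=> n; first by apply: ideal_bigcup_leq.
  move=> x [m /= mn [E [EE_E fE Ex]]]; exists m; first exact: leqW.
  by exists E; split => //; exact: (monEE E EE_E).2.
move=> /infinite_natP/(_ (f E))[n fEn]; apply => x Ex.
by exists (f E) => //; exists E.
Qed.

(** * Uncountable sets of size aleph_1 *)

Lemma well_order_relation (X : Type) : exists r : X -> X -> Prop,
  (forall P : X -> Prop, (exists x, P x) ->
     exists2 z, P z & forall y, P y -> r z y) /\
  (forall x y, r x y -> r y x -> x = y).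
Proof.
have [r r_wo] := wochoice.well_ordering_principle {classic X}.
have minP (P : X -> Prop) : (exists x, P x) ->
    exists! z, P z /\ forall y, P y -> r z y.
  move=> [x Px]; have [|z [[Pz zmin] zuniq]] := r_wo (fun x => `[< P x >]).
    by exists x; exact/asboolP.
  exists z; split.
    split; first exact/asboolP.
    by move=> y Py; apply: zmin; exact/asboolP.
  move=> y [Py ymin]; apply: zuniq; split; first exact/asboolP.
  by move=> y' /asboolP; exact: ymin.
exists (fun x y => r x y); split=> [P /minP[z [[Pz zmin] _]]|x y rxy ryx].
  by exists z.
have r_refl z : r z z by have [|z' [[-> zmin] _]] := minP (eq z); [exists z|exact: zmin].
(* If [r x y] and [r y x], both points are least in the pair, and the least element is unique. *)
have [|z [_ zuniq]] := minP (fun z => z = x \/ z = y); first by exists x; left.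
rewrite -(zuniq x) ?(zuniq y)//.
- by split; [right|move=> w [|] ->].
- by split; [left|move=> w [|] ->].
Qed.

Section Aleph1.
Variables (X : Type) (r : X -> X -> Prop).
Hypothesis least : forall P : X -> Prop, (exists x, P x) ->
  exists2 z, P z & forall y, P y -> r z y.
Hypothesis r_anti : forall x y, r x y -> r y x -> x = y.

Let r_total x y : r x y \/ r y x.
Proof.
have [|z [->|->] zmin] := least (P := fun z => z = x \/ z = y).
- by exists x; left.
- by left; apply: zmin; right.
- by right; apply: zmin; left.
Qed.

Let r_trans x y z : r x y -> r y z -> r x z.
Proof.
move=> rxy ryz.
have [|m mP mmin] := least (P := fun m => [\/ m = x, m = y | m = z]).
  by exists x; constructor 1.
case: mP => mE; rewrite {m}mE in mmin.
- by apply: mmin; constructor 3.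
- by rewrite (r_anti rxy)//; apply: mmin; constructor 1.
- by rewrite -(r_anti ryz)//; apply: mmin; constructor 2.
Qed.

(** If some point of [U] has uncountably many predecessors in [U], the predecessors of the least
    such point form an uncountable set with countable initial segments; otherwise [U] itself is such
    a set. *)
Lemma uncountable_aleph1_of_least (U : set X) : ~ countable U ->
  exists V : set X, [/\ V `<=` U, ~ countable V & card_le_aleph1 V].
Proof.
move=> Uunc; pose lt x y := ~ r y x.
suff [V [VU Vunc Vseg]] : exists V : set X, [/\ V `<=` U, ~ countable V &
    forall y, V y -> countable [set x | V x /\ lt x y]].
  exists V; split; [exact: VU|exact: Vunc|exists lt; split].
  - move=> x; apply: contrapT => nAcc.
    have [|z nz zmin] := least (P := fun z => ~ Acc lt z); first by exists x.
    by apply: nz; constructor => y yz; apply: contrapT => /zmin.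
  - by move=> x nxx; have [] := r_total x x.
  - move=> x y z xy yz rzx; apply: yz; apply: r_trans rzx _.
    by have [//|/xy] := r_total x y.
  - move=> x y _ _; have [rxy|nrxy] := pselect (r x y); last by constructor 3.
    have [ryx|nryx] := pselect (r y x); last by constructor 2.
    by constructor 1; exact: r_anti.
  - exact: Vseg.
pose seg y := [set x | U x /\ lt x y].
have [allc|/existsNP[y0 /not_implyP[Uy0 y0unc]]] :=
    pselect (forall y, U y -> countable (seg y)).
  by exists U; split; [|exact: Uunc|exact: allc].
have [|y [Uy yunc] ymin] := least (P := fun y => U y /\ ~ countable (seg y)).
  by exists y0.
exists (seg y); split; [by move=> x []|exact: yunc|move=> z [Uz zy]].
have : countable (seg z) by apply: contrapT => zunc; apply: zy; exact: ymin.
by apply: sub_countable; apply: subset_card_le => x [[Ux _] xz].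
Qed.

End Aleph1.

Lemma uncountable_aleph1 (X : Type) (U : set X) : ~ countable U ->
  exists V : set X, [/\ V `<=` U, ~ countable V & card_le_aleph1 V].
Proof.
have [r [least r_anti]] := well_order_relation X.
exact (@uncountable_aleph1_of_least X r least r_anti U).
Qed.

Lemma uncountable_image (X Y : Type) (h : X -> Y) (S : set X) :
  injective h -> ~ countable S -> ~ countable (h @` S).
Proof.
move=> h_inj Sunc /countable_injP[f f_inj]; apply: Sunc; apply/countable_injP.
exists (f \o h) => x y /set_mem Sx /set_mem Sy /f_inj hxy.
by apply/h_inj/hxy; rewrite inE; [exists x|exists y].
Qed.

Lemma uncountable_cantor : ~ countable [set: cantor_space].
Proof.
move=> /countable_injP[f f_inj].
pose d : cantor_space := fun n => `[< exists x : cantor_space, f x = n /\ x n = false >].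
have [dm|/negP dm] := boolP (d (f d)).
  have /asboolP[x [/f_inj xd xf]] := dm.
  by rewrite xd ?inE// dm in xf.
have df : d (f d) = false by apply/negbTE/negP.
by apply: dm; rewrite /d; apply/asboolP; exists d.
Qed.

Lemma uncountable_avoid (X Y : Type) (h : X -> Y) (V : set Y) (Z : set X) :
  V `<=` range h -> ~ countable V -> countable Z -> exists2 x, ~ Z x & V (h x).
Proof.
move=> Vh Vunc Zc; apply: contrapT => nx; apply: Vunc.
apply: (@sub_countable _ _ _ (h @` Z)).
  apply: subset_card_le => y Vy; have [x _ hx] := Vh y Vy.
  by exists x => //; apply: contrapT => nZx; apply: nx; exists x => //; rewrite hx.
exact: sub_countable (card_image_le _ _) Zc.
Qed.

(** * Clopen sets of measure one half *)

Definition prefix_tuple n (x : cantor_space) : n.-tuple bool :=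
  [tuple x i | i < n].

Lemma prefix_tuple_ext n (s : n.-tuple bool) : prefix_tuple n (ext s) = s.
Proof. by apply: eq_from_tnth => i; rewrite tnth_mktuple /ext (tnth_nth false). Qed.

Lemma prefix_tupleE n (x y : cantor_space) :
  (forall i, (i < n)%N -> x i = y i) <-> prefix_tuple n x = prefix_tuple n y.
Proof.
split=> [xy|xy i ni]; first by apply: eq_from_tnth => i; rewrite !tnth_mktuple xy.
have := congr1 (fun t => tnth t (Ordinal ni)) xy.
by rewrite !tnth_mktuple.
Qed.

Lemma depends_on_open (A : set cantor_space) n : depends_on A n -> open A.
Proof.
move=> An; rewrite openE => x Ax.
have cyl : nbhs x [set y : cantor_space | forall i, (i < n)%N -> y i = x i].
  elim: n {An} => [|n IHn]; first by apply: filterS filterT.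
  have xn : nbhs x [set y : cantor_space | y n = x n].
    apply: (@proj_continuous nat (fun=> bool) n x [set b | b = x n]).
    exact: discrete_set1.
  apply: filterS (filterI IHn xn) => y [yi yn] i.
  by rewrite ltnS leq_eqVlt => /orP[/eqP ->|/yi].
by apply: filterS cyl => y yx; apply: An Ax => i ni; rewrite yx.
Qed.

Lemma depends_on_clopen (A : set cantor_space) n : depends_on A n -> clopen A.
Proof.
move=> An; split; first exact: depends_on_open An.
rewrite -openC; apply: (@depends_on_open _ n) => x y xy nAx Ay; apply: nAx.
by apply: An Ay => i ni; rewrite xy.
Qed.

(** On [n.+1] coordinates, with [n] large, the prefix of [x] differs from those of [Y], and at least
    [2^n - 1] prefixes belong to none of these points. That many of them, with the prefix of [x],
    make up half of all prefixes. *)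
Lemma half_measure_separation (x : cantor_space) (Y : seq cantor_space) :
  x \notin Y -> exists A : Omega, G_x x A /\ forall y, y \in Y -> ~ G_x y A.
Proof.
move=> xY.
have [N NY] : exists N, forall y, y \in Y -> exists2 i, (i < N)%N & x i <> y i.
  elim: Y xY => [|y Y IHY]; first by exists 0%N.
  rewrite in_cons negb_or => /andP[/eqP xy /IHY[N NY]].
  have [i xyi] : exists i, x i <> y i.
    by apply/existsNP => xy'; apply: xy; apply/funext.
  exists (maxn N i.+1) => y'; rewrite in_cons => /orP[/eqP ->|/NY[j jN xj]].
    by exists i => //; lia.
  by exists j => //; lia.
pose n := (maxn N (size Y)); pose C := [set t in map (prefix_tuple n.+1) (x :: Y)]%SET.
have cC : (#|C| <= (size Y).+1)%N.
  by rewrite cardsE (leq_trans (card_size _))// size_map.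
have : ((2 ^ n).-1 <= #|~: C|%SET)%N.
  have := cardsC C; rewrite card_tuple card_bool expnS.
  have : (size Y <= n)%N by rewrite leq_maxr.
  have := ltn_expl n (ltnSn 1); lia.
move=> /card_geqP[s [us ss sC]].
pose H := [set t in prefix_tuple n.+1 x :: s]%SET.
have xC : prefix_tuple n.+1 x \in C by rewrite inE in_cons eqxx.
have cH : #|H| = (2 ^ n)%N.
  rewrite cardsE; have /card_uniqP -> : uniq (prefix_tuple n.+1 x :: s).
    by rewrite /= us andbT; apply/negP => /sC; rewrite inE xC.
  by rewrite /= ss prednK// expn_gt0.
pose A : set cantor_space := [set z | prefix_tuple n.+1 z \in H].
have An : depends_on A n.+1.
  by move=> u v /prefix_tupleE uv; rewrite /A /= uv.
have hA : half_measure_clopen A.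
  split; first exact: depends_on_clopen An.
  exists n.+1; split => //.
  rewrite (_ : #|_| = (2 ^ n)%N); last first.
    rewrite -cH; apply: eq_card => t; apply/idP/idP => [/set_mem/asboolP|tH].
      by rewrite /A /= prefix_tuple_ext.
    by apply/mem_set/asboolP; rewrite /A /= prefix_tuple_ext.
  rewrite expnS natrM; have : ((2 ^ n)%:R : rat) != 0%R.
    by rewrite pnatr_eq0 expn_eq0.
  by move=> p0; rewrite invfM mulrCA mulfV// mulr1.
exists (exist _ A hA); split; first by rewrite /G_x /= /A /= inE in_cons eqxx.
move=> y yY; rewrite /G_x /= /A /= inE in_cons => /orP[/eqP/prefix_tupleE yx|/sC].
  have [i iN] := NY y yY; apply; rewrite yx// /n; lia.
by rewrite !inE map_f ?orbT.
Qed.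

Lemma Solecki_ideal : is_ideal Solecki.
Proof.
split=> [|A B AB [xs Bxs]|A B [xs Axs] [ys Bys]].
- by exists [::] => A [].
- by exists xs; exact: subset_trans Bxs.
- exists (xs ++ ys) => C [/Axs[x /= xx xC]|/Bys[y /= yy yC]].
    by exists x => //=; rewrite mem_cat xx.
  by exists y => //=; rewrite mem_cat yy orbT.
Qed.

Lemma Solecki_G_x x : Solecki (G_x x).
Proof. by exists [:: x] => A xA; exists x => //=; rewrite inE. Qed.

Lemma G_x_not_covered x (B : set Omega) (ys : seq cantor_space) :
  B `<=` \bigcup_(y in [set y | y \in ys]) G_x y -> x \notin ys ->
  ~ (G_x x `<=` B).
Proof.
move=> Bys /half_measure_separation[A [xA nyA]] /(_ A xA)/Bys[y yys].
exact: nyA.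
Qed.

Lemma G_x_inj : injective G_x.
Proof.
move=> x y xy; apply/eqP; apply: contrapT => /negP nxy.
have [A [xA]] := @half_measure_separation x [:: y] ltac:(by rewrite inE).
by move=> /(_ y (mem_head _ _)); rewrite -xy.
Qed.

(** A set of positive measure depending on finitely many coordinates contains a point that is
    eventually [false], and there are only countably many such points. *)
Lemma Solecki_cover : exists s : nat -> set Omega,
  (forall n, Solecki (s n)) /\ \bigcup_n s n = setT.
Proof.
exists (fun n => if (unpickle n : option (seq bool)) is Some t
  then G_x (fun i => nth false t i) else set0); split.
  move=> n; case: (unpickle n) => [t|]; first exact: Solecki_G_x.
  by have [] := Solecki_ideal.
rewrite -subTset => -[A hA] _; have [_ [n [_ cA]]] := hA.
have [t At] : exists t : n.-tuple bool, A (ext t).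
  apply: contrapT => nt; move: cA; rewrite (_ : #|_| = 0%N).
    by rewrite mul0r => /eqP; rewrite eq_sym div1r invr_eq0.
  apply: eq_card0 => t; rewrite !inE; apply/negbTE/negP => /asboolP/asboolP At.
  by apply: nt; exists t.
by exists (pickle (val t)) => //; rewrite pickleK.
Qed.

Lemma countable_mem_bigcup (xs : nat -> seq cantor_space) :
  countable (\bigcup_n [set x | x \in xs n]).
Proof. by apply: bigcup_countable => // n _; exact/finite_set_countable/finite_seq. Qed.

Lemma addw_Solecki_uncountable (V : set (set Omega)) :
  V `<=` range G_x -> ~ countable V -> addw_wit Solecki V.
Proof.
move=> Vr Vunc; split=> [_ /Vr[x _ <-]|B IB]; first exact: Solecki_G_x.
have [xs Bxs] := ex_choice IB.
have [x nx Vx] := uncountable_avoid Vr Vunc (countable_mem_bigcup xs).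
exists (G_x x) => // n; apply: G_x_not_covered (Bxs n) _.
by apply/negP => xn; apply: nx; exists n.
Qed.

Lemma bsigma_Solecki_uncountable (V : set (nat -> set Omega)) :
  V `<=` range (fun x (n : nat) => G_x x) -> ~ countable V ->
  bsigma_wit Solecki V.
Proof.
move=> Vr Vunc; split=> [_ /Vr[x _ <-]|A [IA _]].
  by split=> n; [exact: Solecki_G_x|].
have [xs Axs] := ex_choice IA.
have [x nx Vx] := uncountable_avoid Vr Vunc (countable_mem_bigcup xs).
eexists; first exact: Vx.
apply/infinite_natP => N; exists N => //; apply: G_x_not_covered (Axs N) _.
by apply/negP => xN; apply: nx; exists N.
Qed.

(** The point made of [i] ones, a zero and then [z]. Each [z] thus owns infinitely many points, none
    shared with another [z]. *)
Definition spread (z : cantor_space) (i : nat) : cantor_space :=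
  fun k => if (k < i)%N then true else if k == i then false else z (k - i.+1)%N.

Lemma spread_inj z z' i j : spread z i = spread z' j -> z = z' /\ i = j.
Proof.
move=> zz'.
have ij : i = j.
  have := congr1 (fun x => x i) zz'; have := congr1 (fun x => x j) zz'.
  rewrite /spread !ltnn !eqxx; case: (ltngtP i j) => //.
subst j; split=> //; apply/funext => k.
have := congr1 (fun x => x (k + i.+1)%N) zz'; rewrite /spread.
by rewrite ltnNge (leq_trans (leqnSn i)) ?leq_addl//= gtn_eqF ?leq_addl// addnK.
Qed.

Definition G_seq z i : set Omega :=
  G_x (spread z i) `\` \bigcup_(j < i) G_x (spread z j).

(* For [z] off a countable set, no point [spread z i] belongs to the countably
   many points used to cover the partition [A]; hence some clopen set contains
   [spread z i] and avoids [A 0, ..., A i]. *)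
Lemma bs_Solecki_uncountable (V : set (nat -> set Omega)) :
  V `<=` range G_seq -> ~ countable V -> bs_wit Solecki V.
Proof.
move=> Vr Vunc; have [_ IS _] := Solecki_ideal; split=> [_ /Vr[z _ <-]|A].
  split=> [i|]; first by apply: IS (Solecki_G_x (spread z i)) => B [].
  have lt_disj i j : (i < j)%N -> G_seq z i `&` G_seq z j = set0.
    by move=> ij; rewrite -subset0 => B [[Bi _] [_]]; apply; exists i.
  move=> i j /eqP; rewrite neq_ltn => /orP[/lt_disj//|/lt_disj]; by rewrite setIC.
move=> [[IA _] Acov]; have [xs Axs] := ex_choice IA.
pose Z := \bigcup_i [set z | (\bigcup_n [set x | x \in xs n]) (spread z i)].
have Zc : countable Z.
  apply: bigcup_countable => // i _.
  have /countable_injP[f f_inj] := countable_mem_bigcup xs.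
  apply/countable_injP; exists (fun z => f (spread z i)) => z z' /set_mem zi /set_mem z'i.
  move=> /f_inj h; have [|] := @spread_inj z z' i i _ => //.
  by apply: h; rewrite inE.
have [z nz Vz] := uncountable_avoid Vr Vunc Zc.
exists (G_seq z) => // -[ys bad_ys].
have [i iys] : exists i, spread z i \notin ys.
  apply: contrapT => ni.
  have := @uniq_leq_size _ (map (spread z) (iota 0 (size ys).+1)) ys.
  rewrite size_map size_iota ltnn => h; suff : false by [].
  apply: h; first by rewrite map_inj_uniq ?iota_uniq// => i j /spread_inj[].
  move=> x /mapP[i _ ->]; apply: contrapT => /negP niy.
  by apply: ni; exists i.
pose L := ys ++ flatten [seq xs n | n <- iota 0 i.+1].
have /half_measure_separation[B [Bi nB]] : spread z i \notin L.
  rewrite mem_cat negb_or iys; apply/negP => /flatten_mapP[n _ zin].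
  by apply: nz; exists i => //; exists n.
have nAB n : (n <= i)%N -> ~ A n B.
  move=> ni /Axs[x /= xn]; apply: nB.
  rewrite mem_cat; apply/orP; right; apply/flatten_mapP; exists n => //.
  by rewrite mem_iota /= add0n ltnS.
have [[|k] _ AkB] : (\bigcup_n A n) B by rewrite Acov.
  by case: (nAB 0%N).
have ik : (i <= k)%N by rewrite leqNgt; apply/negP => ki; apply: (nAB k.+1).
(* The least [j] with [spread z j] in [B] puts [B] into the [j]-th disjointed set; since
   [j <= i <= k], [B] belongs to the bad set. *)
have : exists j, `[< G_x (spread z j) B >] by exists i; apply/asboolP.
move=> /ex_minnP[j /asboolP Bj jmin].
have ji : (j <= i)%N by apply: jmin; apply/asboolP.
have /bad_ys[y /= yys] : (\bigcup_n (A n.+1 `&`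
    \bigcup_(i in [set i | (i <= n)%N]) G_seq z i)) B.
  exists k => //; split => //; exists j; first exact: leq_trans ik.
  split => // -[j' /= j'j Bj']; have := jmin j' (introT (asboolP _) Bj'); lia.
by apply: nB; rewrite mem_cat yys.
Qed.

(** Every uncountable part of the range of [h] is a witness, so an uncountable part of size at most
    aleph_1 gives the upper bound. *)
Lemma omega1_of_uncountable (X Y : Type) (P : set Y -> Prop) (h : X -> Y) :
  injective h -> ~ countable [set: X] ->
  (forall V, V `<=` range h -> ~ countable V -> P V) ->
  (forall E, P E -> ~ countable E) -> mincard_omega1 P.
Proof.
move=> h_inj Xunc PV Punc; split => //.
have [V [Vh Vunc V1]] := uncountable_aleph1 (uncountable_image h_inj Xunc).
by exists V => //; exact: PV.
Qed.

Lemma Solecki_part :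
  [/\ mincard_omega1 (bsigma_wit Solecki), mincard_omega1 (bs_wit Solecki)
    & mincard_omega1 (addw_wit Solecki)].
Proof.
have bc E : bsigma_wit Solecki E -> ~ countable E.
  exact: bsigma_not_countable Solecki_ideal.
have [s [Is sT]] := Solecki_cover.
split.
- apply: omega1_of_uncountable uncountable_cantor bsigma_Solecki_uncountable bc.
  by move=> x y /(congr1 (fun E => E 0%N))/G_x_inj.
- apply: omega1_of_uncountable uncountable_cantor bs_Solecki_uncountable _.
    move=> x y /(congr1 (fun E => E 0%N)); rewrite /G_seq.
    have no0 z : \bigcup_(j < 0) G_x (spread z j) = set0.
      by rewrite -subset0 => B [].
    by rewrite !no0 !setD0 => /G_x_inj/spread_inj[].
  move=> E /(bsigma_le_bs Solecki_ideal Is sT)[D /bc Dunc DE] Ec.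
  by apply: Dunc; exact: sub_countable DE Ec.
- apply: omega1_of_uncountable uncountable_cantor addw_Solecki_uncountable _.
    exact: G_x_inj.
  move=> E /bsigma_le_addw[D /bc Dunc DE] Ec.
  by apply: Dunc; exact: sub_countable DE Ec.
Qed.

(** * Summable ideals *)

Local Open Scope ring_scope.

Definition half (R : realType) (n : nat) : R := 2^-1 ^+ n.

Section Half.
Variable R : realType.
Local Notation half := (half R).

Lemma half_gt0 n : 0 < half n.
Proof. by rewrite /half exprn_gt0. Qed.

Lemma half_ge0 n : 0 <= half n.
Proof. exact/ltW/half_gt0. Qed.

Lemma half0 : half 0 = 1.
Proof. by rewrite /half expr0. Qed.

Lemma halfS n : half n = half n.+1 + half n.+1.
Proof. by rewrite /half exprS; lra. Qed.

Lemma halfD m n : half (m + n) = half m * half n.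
Proof. by rewrite /half exprD. Qed.

Lemma half_le m n : (m <= n)%N -> half n <= half m.
Proof.
move=> mn; rewrite -(subnK mn) addnC halfD ler_piMr ?half_ge0//.
by rewrite /half exprn_ile1//; lra.
Qed.

Lemma half_le1 n : half n <= 1.
Proof. by rewrite -half0; exact: half_le. Qed.

Lemma halfE n : half n = (2 ^ n)%:R^-1.
Proof. by rewrite /half natrX exprVn. Qed.

Lemma half_nat n : half n * (2 ^ n)%:R = 1.
Proof. by rewrite halfE mulVf// pnatr_eq0 expn_eq0. Qed.

Lemma half_small (e : R) : 0 < e -> exists n, half n < e.
Proof.
move=> e0; exists (Num.bound e^-1); rewrite halfE invf_plt ?posrE ?ltr0n ?expn_gt0//.
have := archi_boundP (ltW (etrans (invr_gt0 e) e0)) => /lt_trans; apply.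
by rewrite ltr_nat ltn_expl.
Qed.

Lemma sum_half (n0 K : nat) :
  \sum_(n < K) (n0 <= n)%N%:R * half n <= half n0 + half n0.
Proof.
(* Carrying along the remaining tail, twice [half (maxn K n0)], makes the bound inductive. *)
suff : \sum_(n < K) (n0 <= n)%N%:R * half n + half (maxn K n0) + half (maxn K n0)
    <= half n0 + half n0 by have := half_gt0 (maxn K n0); lra.
elim: K => [|K]; first by rewrite big_ord0 max0n add0r.
rewrite big_ord_recr /=; set S := \sum_(n < K) _; have [n0K|Kn0] := leqP n0 K.
  have -> : maxn K.+1 n0 = K.+1 by lia.
  by have := halfS K; rewrite mul1r; lra.
have -> : maxn K.+1 n0 = n0 by lia.
by rewrite mul0r addr0.
Qed.

End Half.

(** * Partial sums of nonnegative weights *)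

Section WeightedSums.
Variables (R : realType) (w : nat -> R).
Hypothesis w_ge0 : forall i, 0 <= w i.
Implicit Types (A B : set nat) (X : nat -> set nat) (N : nat).

Definition wsum A N : R := \sum_(i < N) (nat_of_ord i \in A)%:R * w i.

Let term_ge0 A i : 0 <= (i \in A)%:R * w i.
Proof. by rewrite mulr_ge0// ler0n. Qed.

Lemma wsum_ge0 A N : 0 <= wsum A N.
Proof. exact: sumr_ge0. Qed.

Lemma wsum_le A B N : (forall i, (i < N)%N -> A i -> B i) -> wsum A N <= wsum B N.
Proof.
move=> AB; apply: ler_sum => i _; rewrite ler_wpM2r// ler_nat.
by case: (boolP (_ \in A)) => // /set_mem/AB/mem_set ->.
Qed.

Lemma wsum_homo A M N : (M <= N)%N -> wsum A M <= wsum A N.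
Proof.
move=> MN; rewrite -(subnKC MN) /wsum.
by rewrite big_split_ord /= lerDl sumr_ge0// => i _.
Qed.

Lemma wsumU A B N : wsum (A `|` B) N <= wsum A N + wsum B N.
Proof.
rewrite -big_split /=; apply: ler_sum => i _; rewrite -mulrDl ler_wpM2r//.
rewrite in_setU; have := ler0n R (nat_of_ord i \in B).
by case: (_ \in A); case: (_ \in B) => /=; lra.
Qed.

Lemma wsumU_disjoint A B N :
  A `&` B = set0 -> wsum (A `|` B) N = wsum A N + wsum B N.
Proof.
move=> AB; rewrite -big_split /=; apply: eq_bigr => i _; rewrite -mulrDl.
congr (_ * _); rewrite in_setU.
have : nat_of_ord i \in A `&` B = false by rewrite AB in_set0.
by rewrite in_setI; case: (_ \in A); case: (_ \in B) => //= _; lra.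
Qed.

Lemma wsum0 N : wsum set0 N = 0.
Proof. by apply: big1 => i _; rewrite in_set0 mul0r. Qed.

Lemma wsum_bigcup A X K N :
  (forall i, (i < N)%N -> A i -> exists2 n, (n < K)%N & X n i) ->
  wsum A N <= \sum_(n < K) wsum (X n) N.
Proof.
move=> AX; apply: le_trans (_ : wsum (\bigcup_(n < K) X n) N <= _).
  by apply: wsum_le => i iN /(AX _ iN)[n nK Xni]; exists n.
rewrite bigcup_mkord; elim: K {AX} => [|K IHK]; first by rewrite !big_ord0 wsum0.
by rewrite !big_ord_recr /=; apply: le_trans (wsumU _ _ _) _; rewrite lerD2r.
Qed.

Lemma sum_wsum_disjoint A X K N :
  (forall n, X n `<=` A) -> (forall m n, m <> n -> X m `&` X n = set0) ->
  \sum_(n < K) wsum (X n) N <= wsum A N.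
Proof.
move=> XA Xdisj.
have -> : \sum_(n < K) wsum (X n) N = wsum (\bigcup_(n < K) X n) N.
  rewrite bigcup_mkord; elim: K => [|K IHK]; first by rewrite !big_ord0 wsum0.
  rewrite !big_ord_recr /= IHK wsumU_disjoint//.
  rewrite -subset0 => x [+ XKx]; rewrite -bigcup_mkord => -[n /= nK Xnx].
  by have := Xdisj n K ltac:(lia); rewrite -subset0 => /(_ x); apply.
by apply: wsum_le => i _ [n _]; exact: XA.
Qed.

(** Below [N] only finitely many of the [X n] are needed to cover [A], and their bounds form part of
    a geometric series starting at [n0]. *)
Lemma wsum_bigcup_geometric A X N (C : R) n0 : 0 <= C ->
  (forall i, (i < N)%N -> A i -> exists2 n, (n0 <= n)%N & X n i) ->
  (forall n, (n0 <= n)%N -> wsum (X n) N <= C * half R n) ->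
  wsum A N <= C * (half R n0 + half R n0).
Proof.
move=> C0 AX Xle.
have [nu nuP] := @choice_on _ _ 0%N [set i | (i < N)%N /\ A i]
  (fun i n => (n0 <= n)%N /\ X n i) (fun i '(conj iN Ai) =>
  let: ex_intro2 n n0n Xni := AX i iN Ai in ex_intro _ n (conj n0n Xni)).
pose K := (\max_(i < N) nu i).+1.
pose X' n := if (n0 <= n)%N then X n else set0.
apply: le_trans (@wsum_bigcup A X' K N _) _.
  move=> i iN Ai; have [n0n Xi] := nuP i (conj iN Ai).
  by exists (nu i); [rewrite ltnS; exact: bigmax_ord_sup|rewrite /X' n0n].
apply: (@le_trans _ _ (C * \sum_(n < K) (n0 <= n)%N%:R * half R n)).
  rewrite mulr_sumr; apply: ler_sum => n _; rewrite /X'.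
  by case: leqP => n0n; rewrite ?mul1r ?Xle// wsum0 mul0r mulr0.
by rewrite ler_wpM2l// sum_half.
Qed.

Lemma wsum1 i N : wsum [set i] N <= w i.
Proof.
have [iN|Ni] := ltnP i N; last first.
  rewrite /wsum big1// => j _; rewrite memNset ?mul0r// => /= ij.
  by have := ltn_ord j; rewrite ij; lia.
rewrite /wsum (bigD1 (Ordinal iN))//= big1 ?addr0.
  by rewrite mem_set// mul1r.
move=> j /eqP ji; rewrite memNset ?mul0r// => /= ij.
by apply: ji; exact: val_inj.
Qed.

Lemma wsum_ge1 A i N : (i < N)%N -> A i -> w i <= wsum A N.
Proof.
move=> iN Ai; rewrite /wsum (bigD1 (Ordinal iN))//= mem_set// mul1r lerDl.
by apply: sumr_ge0.
Qed.

Lemma wsum_trunc A K N : (forall i, A i -> (i < K)%N) -> wsum A N <= wsum A K.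
Proof.
move=> AK; have [KN|/ltnW NK] := leqP K N; last exact: wsum_homo.
rewrite -(subnKC KN) /wsum big_split_ord /= gerDl big1// => i _.
by rewrite memNset ?mul0r// => /AK; lia.
Qed.

(** For nonnegative weights, convergence of the sum amounts to bounded partial sums. *)
Definition I_sum : set (set nat) :=
  [set A | exists M : R, forall N, wsum A N <= M].

Lemma I_sum_ideal : is_ideal I_sum.
Proof.
split=> [|A B AB [M BM]|A B [M AM] [M' BM']].
- by exists 0 => N; rewrite wsum0.
- by exists M => N; apply: le_trans (BM N); apply: wsum_le => i _; exact: AB.
- by exists (M + M') => N; apply: le_trans (wsumU _ _ _) _; exact: lerD.
Qed.

Lemma I_sum_Fin : Fin `<=` I_sum.
Proof.
move=> A /finite_natP[K AK]; exists (wsum A K) => N; exact: wsum_trunc.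
Qed.

(** The cut [c] is taken where the partial sum comes within [2^-n] of the supremum. *)
Lemma I_sum_tail A n : I_sum A ->
  exists c, forall N, wsum (A `&` [set i | (c <= i)%N]) N <= half R n.
Proof.
move=> [M AM]; pose S := [set wsum A N | N in [set: nat]].
have supS : has_sup S.
  by split; [exists (wsum A 0), 0%N|exists M => _ [N _ <-]].
have [_ [c _ <-] Sc] := sup_adherent (half_gt0 R n) supS.
exists c => N.
have : wsum A (maxn c N) <= sup S.
  by apply: (ub_le_sup (proj2 supS)); exists (maxn c N).
have : wsum (A `&` [set i | (c <= i)%N]) N
    <= wsum (A `&` [set i | (c <= i)%N]) (maxn c N) by apply: wsum_homo; lia.
have -> : wsum A (maxn c N) = wsum (A `&` [set i | (c <= i)%N]) (maxn c N) +
    wsum (A `&` [set i | (i < c)%N]) (maxn c N).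
  rewrite -wsumU_disjoint; last by rewrite -subset0 => i [[_ /= ?] [_ /= ?]]; lia.
  rewrite -setIUr; congr wsum; rewrite [X in _ `&` X](_ : _ = setT) ?setIT//.
  by rewrite -subTset => i _ /=; case: (leqP c i); [left|right].
have : wsum A c <= wsum (A `&` [set i | (i < c)%N]) (maxn c N).
  apply: le_trans (@wsum_homo _ c (maxn c N) _); last lia.
  by apply: wsum_le => i ic Ai.
lra.
Qed.

Lemma I_sum_bigcup X (C : R) : 0 <= C ->
  (forall n N, wsum (X n) N <= C * half R n) -> I_sum (\bigcup_n X n).
Proof.
move=> C0 XC; exists (C * (half R 0 + half R 0)) => N.
by apply: (@wsum_bigcup_geometric _ X) => // i _ [n _ Xni]; exists n.
Qed.

End WeightedSums.

(** A uniform form of the P-ideal property: [c B n] tells how far [B] must be cut off at stage [n],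
    and any later cut [t n] is allowed too, so that one function can serve many sequences. *)
Definition exhaustive (I : set (set nat)) :=
  exists c : set nat -> nat -> nat,
    forall (B : nat -> set nat) (t : nat -> nat), (forall n, I (B n)) ->
    (forall n, (c (B n) n <= t n)%N) ->
    I (\bigcup_n (B n `&` [set i | (t n <= i)%N])).

Lemma I_sum_exhaustive (R : realType) (w : nat -> R) :
  (forall i, 0 <= w i) -> exhaustive (I_sum w).
Proof.
move=> w0; have ex_c A : I_sum w A -> exists c : nat -> nat, forall n N,
    wsum w (A `&` [set i | (c n <= i)%N]) N <= half R n.
  by move=> IA; apply: (ex_choice (fun n => I_sum_tail w0 n IA)).
have [c cP] := choice_on (fun=> 0%N) ex_c.
exists c => B t IB ct; apply: (@I_sum_bigcup R w w0 _ 1) => // n N.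
rewrite mul1r; apply: le_trans (cP _ (IB n) n N); apply: wsum_le => // i _ [Bi /= ti].
by split => //=; apply: leq_trans ti.
Qed.

(* The partition into the intervals [[g n, g n.+1)] leaves in the bad set only
   the part of [E 0, ..., E n] lying beyond [g n]. *)
Lemma b_le_bs_exhaustive (I : set (set nat)) :
  is_ideal I -> Fin `<=` I -> exhaustive I -> mincard_le b_wit (bs_wit I).
Proof.
move=> idI FinI [c cP]; have [I0 IS IU] := idI.
pose U (E : nat -> set nat) n := \bigcup_(i in [set i | (i <= n)%N]) E i.
apply: mincard_le_image => EE [hatEE bsEE]; exists (fun E n => c (U E n) n).
apply: contrapT => /dominating_increasing[g [gS gdom]].
pose A n := if n is m.+1 then [set i | (g m <= i < g m.+1)%N]
            else [set i | (i < g 0)%N].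
have Alt m n : (m < n)%N -> A m `&` A n = set0.
  case: n => // n; rewrite ltnS => mn; rewrite -subset0 => x.
  have := increasing_leq gS mn.
  by case: m mn => [|m] mn /= ? [/= ? ?]; lia.
have [|E EE_E] := bsEE A.
  split; first split.
  - case=> [|n]; apply: FinI; first exact: finite_II.
    by apply/finite_natP; exists (g n.+1) => i /=; lia.
  - move=> m n /eqP; rewrite neq_ltn => /orP[/Alt//|/Alt]; by rewrite setIC.
  - rewrite -subTset => x _.
    have : exists n, (x < g n)%N by exists x.+1; have := increasing_ge_id x.+1 gS; lia.
    move=> /ex_minnP[[|n] xn xmin]; first by exists 0%N.
    exists n.+1 => //=; rewrite xn andbT leqNgt; apply/negP => /xmin; lia.
apply.
have [N EN] : exists N, forall n, (N <= n)%N -> (c (U E n) n < g n)%N.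
  by apply: gdom; exists E.
have IU' n : I (U E n) by apply: ideal_bigcup_leq => //; case: (hatEE E EE_E).
(* Stage [n >= N] contributes only points beyond [g n], hence beyond the cut of [U E n]; the earlier
   stages stay below [g N]. *)
apply: (IS _ ([set i | (i < g N)%N] `|` \bigcup_n (U E n `&`
  [set i | (maxn (c (U E n) n) (g n) <= i)%N]))); last first.
  by apply: IU; [exact/FinI/finite_II|apply: cP => // n; exact: leq_maxl].
move=> x [n _ [/= xg Ux]]; have [Nn|nN] := leqP N n.
  by right; exists n => //; split=> //=; have := EN n Nn; lia.
by left => /=; have := increasing_leq gS nN; lia.
Qed.

(* The pseudo-union [p E] contains every [E n] up to a finite set. *)
Lemma min_b_addw_le_bsigma (X : Type) (P : set X -> Prop) (I : set (set nat)) :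
  is_ideal I -> Fin `<=` I -> exhaustive I ->
  mincard_le P b_wit -> mincard_le P (addw_wit I) -> mincard_le P (bsigma_wit I).
Proof.
move=> idI FinI [c cP] Pb Paddw EE [monEE bEE]; have [I0 IS IU] := idI.
pose p (E : nat -> set nat) := \bigcup_n (E n `&` [set i | (c (E n) n <= i)%N]).
have Ip E : EE E -> I (p E).
  by move=> /monEE[IE _]; apply: (cP E (fun n => c (E n) n)).
have [/Paddw[S PS SE]|naddw] := pselect (addw_wit I (p @` EE)).
  by exists S => //; apply: card_le_trans SE (card_image_le _ _).
have [B IB pB] : exists2 B : nat -> set nat, (forall n, I (B n)) &
    forall E, EE E -> exists m, p E `<=` B m.
  apply: contrapT => noB; apply: naddw; split; first by move=> _ [E /Ip ? <-].
  move=> B IB; apply: contrapT => noA; apply: noB; exists B => // E EE_E.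
  apply: contrapT => noE; apply: noA; exists (p E); first by exists E.
  by move=> n pE; apply: noE; exists n.
have [mu muP] := choice_on 0%N pB.
(* The code bounds both the index of a set [B m] containing [p E] and the cut of [E n], so that one
   function [g] controls both. *)
pose code (E : nat -> set nat) n := (mu E + c (E n) n)%N.
have [/Pb[S PS SE]|/dominating_increasing[g [gS gdom]]] := pselect (b_wit (code @` EE)).
  by exists S => //; apply: card_le_trans SE (card_image_le _ _).
pose A n := [set i | (i < g n)%N] `|` \bigcup_(i in [set i | (i <= g n)%N]) B i.
have [|E EE_E /infinite_natP Einf] := bEE A.
  split=> n; first by apply: IU; [exact/FinI/finite_II|exact: ideal_bigcup_leq].
  have gn := gS n n.+1 (ltnSn n).
  by apply: setUSS => [i /= ?|]; [lia|apply: bigcup_leqS; exact: ltnW].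
have [N EN] : exists N, forall n, (N <= n)%N -> (code E n < g n)%N.
  by apply: gdom; exists E.
have [n Nn []] := Einf N => i Ei; have := EN n Nn; rewrite /code => codeg.
have [ci|ic] := leqP (c (E n) n) i; last by left => /=; lia.
right; exists (mu E); first by move=> /=; lia.
by apply: muP => //; exists n.
Qed.

(** * Density *)

Lemma increasing_locate (g : nat -> nat) n0 i :
  {homo g : m n / (m < n)%N} -> (g n0 <= i)%N ->
  exists2 n, (n0 <= n)%N & (g n <= i < g n.+1)%N.
Proof.
move=> gS g0i; have : exists n, (i < g n)%N.
  by exists i.+1; have := increasing_ge_id i.+1 gS; lia.
move=> /ex_minnP[[|n] ign nmin].
  by have := increasing_leq gS (leq0n n0); lia.
exists n; last by rewrite ign andbT leqNgt; apply/negP => /nmin; rewrite ltnn.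
by rewrite leqNgt; apply/negP => /(increasing_leq gS); lia.
Qed.

Lemma wsum_weight (R : realType) (w w' : nat -> R) (C : R) (A : set nat) N :
  (forall i, (i < N)%N -> A i -> w i <= C * w' i) ->
  wsum w A N <= C * wsum w' A N.
Proof.
move=> ww'; rewrite /wsum mulr_sumr; apply: ler_sum => i _.
rewrite mulrCA; case: (boolP (_ \in A)) => [/set_mem Ai|_]; last by rewrite !mul0r.
by rewrite !mul1r ww'.
Qed.

Section Density.
Variable R : realType.
Local Notation half := (half R).

Definition wblock (m i : nat) : R := (2 ^ m <= i)%N%:R * half m.

Lemma wblock_ge0 m i : 0 <= wblock m i.
Proof. by rewrite mulr_ge0 ?half_ge0. Qed.

(** The relative density of [A] in the dyadic block from [2^m] to [2^(m+1)], written as a weighted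
    sum so that the lemmas on [wsum] apply. *)
Definition dens (A : set nat) m : R := wsum (wblock m) A (2 ^ m.+1).

Lemma dens_le (A B : set nat) m :
  (forall i, (2 ^ m <= i < 2 ^ m.+1)%N -> A i -> B i) -> dens A m <= dens B m.
Proof.
move=> AB; apply: ler_sum => i _; rewrite /wblock.
case: leqP => mi; last by rewrite !mul0r !mulr0.
rewrite mul1r ler_wpM2r ?half_ge0// ler_nat.
case: (boolP (_ \in A)) => // /set_mem Ai.
by rewrite mem_set//; apply: AB Ai; rewrite mi ltn_ord.
Qed.

Lemma densE A m :
  dens A m = half m * \sum_(j < 2 ^ m) ((2 ^ m + j)%N \in A)%:R.
Proof.
rewrite /dens [X in wsum _ _ X](_ : _ = 2 ^ m + 2 ^ m)%N; last first.
  by rewrite expnS mul2n addnn.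
rewrite /wsum big_split_ord /= big1 ?add0r => [|i _]; last first.
  by rewrite /wblock leqNgt ltn_ord mul0r mulr0.
by rewrite mulr_sumr; apply: eq_bigr => i _; rewrite /wblock leq_addr mul1r mulrC.
Qed.

Lemma count_below_dens A m : (count_below A (2 ^ m.+1))%:R =
  (count_below A (2 ^ m))%:R + dens A m * (2 ^ m)%:R :> R.
Proof.
rewrite densE mulrAC half_nat mul1r -natr_sum -natrD /count_below.
have -> : (2 ^ m.+1 = 2 ^ m + 2 ^ m)%N by rewrite expnS mul2n addnn.
by rewrite big_split_ord.
Qed.

Lemma count_below_homo A m n : (m <= n)%N -> (count_below A m <= count_below A n)%N.
Proof. by move=> mn; rewrite -(subnKC mn) /count_below big_split_ord leq_addr. Qed.

Lemma count_below_le A n : (count_below A n <= n)%N.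
Proof.
rewrite -[leqRHS]card_ord -sum1_card; apply: leq_sum => i _.
by case: (_ \in A).
Qed.

(** A block makes up half of the initial segment it ends, so small global density forces small block
    density. Conversely the counts add up over the blocks, and every [k] is within a factor 2 of a
    power of two. *)
Lemma I_dP A :
  I_d R A <-> forall n, exists M, forall m, (M <= m)%N -> dens A m <= half n.
Proof.
split=> [/cvgrPdist_lt Ad n|densA].
  have [M _ MA] := Ad (half n.+2) (half_gt0 _ _).
  exists M => m Mm; have := MA (2 ^ m.+1)%N.
  rewrite /= sub0r normrN ger0_norm; last by rewrite divr_ge0.
  rewrite ltr_pdivrMr ?ltr0n// => cA.
  have {cA}cA := cA ltac:(by apply: leq_trans Mm
    (leq_trans (leqnSn m) (ltnW (ltn_expl _ _)))).
  have := count_below_dens A m.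
  have : 0 <= (count_below A (2 ^ m))%:R :> R by [].
  have : half n.+2 * (2 ^ m.+1).+1%:R <= half n * (2 ^ m)%:R.
    rewrite (halfS R n) (halfS R n.+1).
    have : ((2 ^ m.+1).+1 <= 4 * 2 ^ m)%N.
      by have := expn_gt0 2 m; rewrite expnS /=; lia.
    rewrite -(ler_nat R) natrM => /(ler_wpM2l (half_ge0 R n.+2)).
    by move/le_trans; apply; rewrite mulrA ler_wpM2r//; lra.
  have p2 : 0 < (2 ^ m)%:R :> R by rewrite ltr0n expn_gt0.
  move=> h1 h2 h3; rewrite -(ler_pM2r p2); lra.
apply/cvgrPdist_lt => e e0.
have [n ne] := half_small (divr_gt0 e0 (ltr0n R 4)).
have [M MA] := densA n.
have pow m : (M <= m)%N ->
    (count_below A (2 ^ m))%:R <= (2 ^ M)%:R + half n * (2 ^ m)%:R.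
  elim: m => [|m IHm].
    rewrite leqn0 => /eqP ->; rewrite ler_wpDr ?mulr_ge0 ?half_ge0//.
    by rewrite ler_nat count_below_le.
  rewrite leq_eqVlt => /orP[/eqP <-|].
    by rewrite ler_wpDr ?mulr_ge0 ?half_ge0// ler_nat count_below_le.
  rewrite ltnS => Mm; rewrite count_below_dens.
  have := ler_wpM2r (ler0n R (2 ^ m)) (MA m Mm); have := IHm Mm.
  rewrite (_ : (2 ^ m.+1)%:R = (2 ^ m)%:R + (2 ^ m)%:R :> R); first lra.
  by rewrite expnS mul2n -addnn natrD.
have bnd k : (0 < k)%N ->
    (count_below A k)%:R <= (2 ^ M)%:R + half n * (k%:R + k%:R).
  move=> k0; pose m := trunc_log 2 k.
  have km : (k < 2 ^ m.+1)%N by exact: trunc_log_ltn.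
  have mk : (2 ^ m.+1 <= k + k)%N.
    by rewrite expnS mul2n -addnn leq_add// trunc_logP.
  have [Mm|mM] := leqP M m.+1.
    apply: le_trans (_ : (count_below A (2 ^ m.+1))%:R <= _).
      by rewrite ler_nat count_below_homo// ltnW.
    apply: le_trans (pow _ Mm) _; rewrite lerD2l ler_wpM2l ?half_ge0//.
    by rewrite -natrD ler_nat.
  apply: ler_wpDr; first by rewrite mulr_ge0 ?half_ge0.
  rewrite ler_nat (leq_trans (count_below_le _ _))// ltnW// (ltn_trans km)//.
  by rewrite ltn_exp2l.
exists (Num.bound ((2 ^ M)%:R / (e / 2))).+1 => // k /= Kk.
rewrite sub0r normrN ger0_norm; last by rewrite divr_ge0.
rewrite ltr_pdivrMr ?ltr0n//.
have k0 : (0 < k)%N by lia.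
apply: le_lt_trans (bnd k k0) _.
have : (2 ^ M)%:R / (e / 2) < k%:R.
  apply: lt_trans (archi_boundP _) _; first by rewrite divr_ge0// ltW// divr_gt0.
  by rewrite ltr_nat.
rewrite ltr_pdivrMr ?divr_gt0// => h1.
have : half n * (k%:R + k%:R) <= e / 4%:R * (k%:R + k%:R).
  by rewrite ler_wpM2r// ?addr_ge0// ltW.
by rewrite -[k.+1]addn1 natrD; nra.
Qed.

Lemma dens_bigcup_geometric A (X : nat -> set nat) m (C : R) n0 : 0 <= C ->
  (forall i, A i -> exists2 n, (n0 <= n)%N & X n i) ->
  (forall n, (n0 <= n)%N -> dens (X n) m <= C * half n) ->
  dens A m <= C * (half n0 + half n0).
Proof.
move=> C0 AX XC; apply: (wsum_bigcup_geometric _ C0 _ XC).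
  by move=> i; exact: wblock_ge0.
by move=> i _; exact: AX.
Qed.

Lemma densU A B m : dens (A `|` B) m <= dens A m + dens B m.
Proof. by apply: wsumU => i; exact: wblock_ge0. Qed.

Lemma I_d_ideal : is_ideal (I_d R).
Proof.
split=> [|A B AB /I_dP dB|A B /I_dP dA /I_dP dB]; apply/I_dP => n.
- by exists 0%N => m _; rewrite /dens wsum0 half_ge0.
- have [M MB] := dB n; exists M => m /MB; apply: le_trans.
  by apply: dens_le => i _; exact: AB.
- have [M MA] := dA n.+1; have [M' MB] := dB n.+1; exists (maxn M M') => m mM.
  apply: le_trans (densU _ _ _) _; rewrite halfS lerD ?MA ?MB//; lia.
Qed.

Lemma I_d_Fin : Fin `<=` I_d R.
Proof.
move=> A /finite_natP[K AK]; apply/I_dP => n; exists K => m Km.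
apply: le_trans (_ : dens set0 m <= _); last by rewrite /dens wsum0 half_ge0.
by apply: dens_le => i im /AK; have := ltn_expl m (ltnSn 1); lia.
Qed.

(** Cutting [B n] at [2^c] leaves density at most [2^-n] in every block. Finitely many pieces have a
    union in the ideal, and the others contribute a geometric tail. *)
Lemma I_d_exhaustive : exhaustive (I_d R).
Proof.
have ex_c A : I_d R A -> exists c : nat -> nat, forall n m,
    (c n <= m)%N -> dens A m <= half n.
  by move=> /I_dP dA; exact: (ex_choice dA).
have [c cP] := choice_on (fun=> 0%N) ex_c.
exists (fun B n => 2 ^ c B n)%N => B t IB ct.
pose B' n := B n `&` [set i | (t n <= i)%N].
have IB' n : I_d R (B' n).
  by have [_ IS _] := I_d_ideal; apply: IS (IB n); exact: subIsetl.
have B'le n m : dens (B' n) m <= half n.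
  have [cm|mc] := leqP (c (B n) n) m.
    by apply: le_trans (cP _ (IB n) _ _ cm); apply: dens_le => i _ [].
  apply: le_trans (_ : dens set0 m <= _); last by rewrite /dens wsum0 half_ge0.
  apply: dens_le => i im [_ /= ti].
  have : (2 ^ m.+1 <= 2 ^ c (B n) n)%N by rewrite leq_exp2l.
  by have := ct n; lia.
apply/I_dP => n.
have /I_dP/(_ n.+1)[M MP] := ideal_bigcup_leq n.+2 I_d_ideal IB'.
exists M => m Mm.
pose C := \bigcup_(i in [set i | (n.+2 <= i)%N]) B' i.
apply: le_trans (_ : dens (\bigcup_(i in [set i | (i <= n.+2)%N]) B' i `|` C) m <= _).
  apply: dens_le => i _ [j _ B'ji].
  by have [jn|/ltnW nj] := leqP j n.+2; [left|right]; exists j.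
apply: le_trans (densU _ _ _) _; rewrite (halfS R n) lerD ?MP//.
rewrite (halfS R n.+1) -[leRHS]mul1r.
apply: (@dens_bigcup_geometric _ B' _ 1) => //.
by move=> j _; rewrite mul1r.
Qed.

(** A power of two below [1/(i+1)] and within a factor 2 of it; being of the form [2^-(k i)] with
    [k i > 0], it is the measure of a condition on [k i] binary digits. *)
Definition w1n (i : nat) : R := half (trunc_log 2 i.+1).+1.

Lemma w1n_ge0 i : 0 <= w1n i.
Proof. exact: half_ge0. Qed.

Lemma w1n_le i : w1n i <= i.+1%:R^-1.
Proof.
rewrite /w1n halfE lef_pV2 ?posrE ?ltr0n ?expn_gt0// ler_nat ltnW//.
exact: trunc_log_ltn.
Qed.

Lemma w1n_ge i : i.+1%:R^-1 <= 2 * w1n i.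
Proof.
rewrite /w1n mulr_natl mulr2n -halfS halfE.
by rewrite lef_pV2 ?posrE ?ltr0n ?expn_gt0// ler_nat trunc_logP.
Qed.

Lemma I_1nP : I_1n R = I_sum w1n.
Proof.
have psum A n : (\sum_(0 <= i < n | i \in A) (i.+1%:R^-1 : R)%:E =
    (wsum (fun i => i.+1%:R^-1 : R) A n)%:E)%E.
  rewrite /wsum big_mkord -sumEFin big_mkcond /=; apply: eq_bigr => i _.
  by case: (_ \in A); rewrite ?mul1r ?mul0r.
apply/seteqP; split=> A; rewrite /I_1n /=.
  move=> Afin; set s := (\sum_(n <oo | _) _)%E in Afin.
  have s0 : (0 <= s)%E by apply: nneseries_ge0 => n _ _; rewrite lee_fin.
  exists (fine s) => N; rewrite -lee_fin fineK ?ge0_fin_numE//.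
  apply: le_trans (_ : (\sum_(0 <= i < N | i \in A) (i.+1%:R^-1 : R)%:E <= _)%E).
    rewrite psum lee_fin -[leRHS]mul1r; apply: wsum_weight => i _ _.
    by rewrite mul1r w1n_le.
  by apply: nneseries_lim_ge => n _ _; rewrite lee_fin.
move=> [M MA]; apply: le_lt_trans (ltry (2 * M)).
apply: lime_le; first by apply: is_cvg_nneseries_cond => n _ _; rewrite lee_fin.
apply: nearW => N; rewrite psum lee_fin.
apply: le_trans (_ : 2 * wsum w1n A N <= _); last by rewrite ler_pM2l.
by apply: wsum_weight => i _ _; exact: w1n_ge.
Qed.

(** In the [m]-th dyadic block the weights are at least [2^-(m+2)], so the density there is at most
    four times a tail of the sum. *)
Lemma I_1n_sub_I_d : I_sum w1n `<=` I_d R.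
Proof.
move=> A IA; apply/I_dP => n.
have [c cP] := I_sum_tail w1n_ge0 n.+2 IA.
exists c => m cm; apply: le_trans (_ : dens (A `&` [set i | (c <= i)%N]) m <= _).
  by apply: dens_le => i im Ai; split=> //=; have := ltn_expl m (ltnSn 1); lia.
apply: le_trans (_ : 4 * wsum w1n (A `&` [set i | (c <= i)%N]) (2 ^ m.+1) <= _).
  apply: wsum_weight => i im _; rewrite /wblock.
  case: leqP => mi; last by rewrite mul0r mulr_ge0 ?w1n_ge0.
  rewrite mul1r; apply: le_trans (_ : 4 * half m.+2 <= _).
    by rewrite (halfS R m) (halfS R m.+1); lra.
  rewrite ler_pM2l// /w1n; apply: half_le; rewrite ltnS -ltnS.
  have : (2 ^ trunc_log 2 i.+1 <= 2 ^ m.+1)%N.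
    by apply: leq_trans (trunc_logP _ _) _.
  by rewrite leq_exp2l.
have := cP (2 ^ m.+1)%N; rewrite (halfS R n) (halfS R n.+1); lra.
Qed.

Lemma wsum_w1n_block X m N : (forall i, X i -> (2 ^ m <= i < 2 ^ m.+1)%N) ->
  wsum w1n X N <= dens X m.
Proof.
move=> Xm; apply: le_trans (@wsum_trunc _ _ w1n_ge0 X (2 ^ m.+1) N _) _.
  by move=> i /Xm/andP[].
rewrite -[leRHS]mul1r; apply: wsum_weight => i im /Xm/andP[mi _].
rewrite mul1r /wblock mi mul1r /w1n; apply: half_le; apply: leq_trans (leqnSn _).
by apply: trunc_log_max => //; exact: leqW.
Qed.

Lemma sum_ltn_ord (K l : nat) : (l <= K)%N -> (\sum_(j < K) (j < l)%N = l)%N.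
Proof.
move=> lK; rewrite -(subnKC lK) big_split_ord /= [X in (_ + X)%N]big1.
  rewrite addn0 -[RHS]card_ord -sum1_card; apply: eq_bigr => i _.
  by rewrite ltn_ord.
by move=> i _; rewrite ltnNge leq_addr.
Qed.

(* A set of [I] containing the [n]-th piece of [A f], which has density [2^-n]
   in the block [f n + n], forces [f n] to be small. *)
Lemma addw_le_b_density (I : set (set nat)) :
  I_sum w1n `<=` I -> I `<=` I_d R -> mincard_le (addw_wit I) b_wit.
Proof.
move=> subI Isub; apply: mincard_le_image => F Fb.
pose X (f : nat -> nat) n :=
  [set i | (2 ^ (f n + n) <= i < 2 ^ (f n + n) + 2 ^ f n)%N].
have densX f n : dens (X f n) (f n + n) = half n.
  rewrite densE (_ : \sum_(j < _) _ = (2 ^ f n)%:R).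
    by rewrite halfD mulrAC half_nat mul1r.
  rewrite -[in RHS](@sum_ltn_ord (2 ^ (f n + n)) (2 ^ f n)) ?leq_exp2l ?leq_addr//.
  rewrite natr_sum; apply: eq_bigr => j _; congr (nat_of_bool _)%:R.
  by apply/idP/idP => [/set_mem|?]; [|apply/mem_set]; rewrite /X /= leq_addr ltn_add2l.
exists (fun f => \bigcup_n X f n); split.
  move=> _ [f _ <-]; apply: subI; apply: (@I_sum_bigcup _ _ w1n_ge0 _ 1) => // n N.
  rewrite mul1r -(densX f n); apply: wsum_w1n_block => i /= /andP[-> /= ilt].
  apply: leq_trans ilt _; rewrite expnS mul2n -addnn leq_add2l leq_exp2l//.
  exact: leq_addr.
move=> B IB.
have [G GP] := ex_choice (fun j => ex_choice (fun n => (I_dP _).1 (Isub _ (IB j)) n.+1)).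
have [f Ff nfg] := Fb (fun n => \max_(j < n.+1) G j n)%N.
exists (\bigcup_n X f n); first by exists f.
move=> j AB; apply: nfg; exists j => n jn.
apply: leq_trans (@bigmax_ord_sup (fun i => G i n) n.+1 j jn).
rewrite leqNgt; apply/negP => Gf.
have : half n <= half n.+1.
  rewrite -(densX f n); apply: le_trans (GP j n (f n + n)%N _); last lia.
  by apply: dens_le => i _ Xi; apply: AB; exists n.
by have := half_gt0 R n.+1; have := halfS R n; lra.
Qed.

(** The blocks are the dyadic ones, and large means density at least [1/2]; a set of [I_d] has
    density at most [1/4] in almost every block. *)
Lemma bs_le_b_density (I : set (set nat)) :
  is_ideal I -> Fin `<=` I -> I `<=` I_d R -> mincard_le (bs_wit I) b_wit.
Proof.
move=> idI FinI Isub.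
pose P m := [set i | (2 ^ m <= i < 2 ^ m.+1)%N].
have densP m : dens (P m) m = 1.
  rewrite densE (eq_bigr (fun=> 1)); last first.
    move=> j _; rewrite mem_set// /P /= leq_addr /= expnS mul2n -addnn ltn_add2l.
    exact: ltn_ord.
  by rewrite sumr_const card_ord half_nat.
apply: (@bs_le_b _ I P (fun m A => half 1 <= dens A m)) => //.
- by move=> m; apply: FinI; apply/finite_natP; exists (2 ^ m.+1)%N => i /andP[].
- have Plt m n : (m < n)%N -> P m `&` P n = set0.
    move=> mn; rewrite -subset0 => i [/= /andP[_ im] /andP[ni _]].
    by have : (2 ^ m.+1 <= 2 ^ n)%N; [rewrite leq_exp2l|lia].
  move=> m n /eqP; rewrite neq_ltn => /orP[/Plt//|/Plt]; by rewrite setIC.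
- by move=> m A B AB /le_trans; apply; apply: dens_le => i _; exact: AB.
- move=> B /Isub/I_dP/(_ 1)[N NB]; exists N => m /NB Bm.
  have : dens (P m) m <= dens ((P m `\` B) `|` B) m.
    by apply: dens_le => i _ Pi; have [|] := pselect (B i); [right|left].
  rewrite densP => /le_trans/(_ (densU _ _ _)).
  by have := halfS R 0; rewrite half0; lra.
- move=> B /Isub/I_dP/(_ 2)[N NB] /(_ N)[m /NB Bm].
  by have := half_gt0 R 2; have := halfS R 1; lra.
Qed.

End Density.

(** * Reductions between summable ideals and density *)

(** There are [q^|S| * (q+1)^(p-|S|)] such functions; the factor [(q+1)^|S|] removes the
    subtraction. *)
Lemma card_avoid_ord0 (p q : nat) (S : {set 'I_p}) :
  (#|[set s : {ffun 'I_p -> 'I_q.+1} | [forall j in S, s j != ord0]]%SET| *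
    q.+1 ^ #|S| = q ^ #|S| * q.+1 ^ p)%N.
Proof.
pose F (j : 'I_p) : pred 'I_q.+1 := if j \in S then predC1 ord0 else predT.
have -> : #|[set s : {ffun 'I_p -> 'I_q.+1} | [forall j in S, s j != ord0]]%SET|
    = #|family F|.
  apply: eq_card => s; rewrite inE; apply/forallP/familyP => sF j.
    by have := sF j; rewrite /F; case: (j \in S) => //= ->.
  by apply/implyP => jS; have := sF j; rewrite /F jS.
rewrite card_family foldrE big_map big_enum /=.
rewrite (bigID (mem S)) /= (eq_bigr (fun=> q)); last first.
  move=> j jS; rewrite /F jS.
  by rewrite cardC1 card_ord.
rewrite [X in (_ * X * _)%N](eq_bigr (fun=> q.+1)); last first.
  by move=> j /negbTE jS; rewrite /F jS (eq_card (B := 'I_q.+1)) ?card_ord.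
rewrite !prod_nat_const -mulnA -expnD; congr (_ * _ ^ _)%N.
by rewrite -[in RHS](card_ord p) -(cardC S) addnC.
Qed.

(** Bernoulli's inequality [(1 + 1/q)^s >= 1 + s/q], cleared of denominators. *)
Lemma double_expn_le (q s : nat) : (q < s)%N -> (2 * q ^ s <= q.+1 ^ s)%N.
Proof.
case: q => [|q] qs; first by rewrite exp0n.
have H t : ((q.+1 + t) * q.+1 ^ t <= q.+1 * q.+2 ^ t)%N.
  elim: t => [|t IHt]; first by rewrite !expn0; lia.
  rewrite !expnS; set a := (q.+1 ^ t)%N in IHt *; set b := (q.+2 ^ t)%N in IHt *.
  apply: leq_trans (_ : q.+2 * ((q.+1 + t) * a) <= _)%N; last nia.
  nia.
rewrite -(leq_pmul2l (ltn0Sn q)); apply: leq_trans (H s).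
rewrite mulnA leq_mul2r; apply/orP; right; lia.
Qed.

Section SumReduction.
Variable R : realType.
Local Notation half := (half R).
Local Notation dens := (@dens R).

Lemma dens_image (T : finType) m (cT : #|T| = (2 ^ m)%N) (S : {set T}) :
  dens [set i | exists2 s, s \in S & i = (2 ^ m + enum_rank s)%N] m =
  half m * #|S|%:R.
Proof.
rewrite densE (reindex (fun s : T => cast_ord cT (enum_rank s))); last first.
  apply: onW_bij; exists (fun j => enum_val (cast_ord (esym cT) j)) => x.
    by rewrite cast_ordK enum_rankK.
  by rewrite enum_valK cast_ordKV.
congr (_ * _); rewrite -[X in _ = X%:R]sum1_card natr_sum [RHS]big_mkcond /=.
apply: eq_bigr => s _; case: ifPn => sS.
  by rewrite mem_set//; exists s.
rewrite memNset// => -[s' s'S] /addnI/val_inj/enum_rank_inj ss'.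
by rewrite ss' s'S in sS.
Qed.

(* The block [2^m, 2^(m+1)) is identified with the functions from [G + 1]
   points to [2^n] values, and [X j] is the event that the [j]-th value is [0]. *)
Lemma independent_blocks n G : exists m (X : nat -> set nat),
  [/\ (n <= m)%N,
      forall j i, X j i -> (2 ^ m <= i < 2 ^ m.+1)%N,
      forall j, (j <= G)%N -> dens (X j) m <= half n &
      forall S : {set 'I_G.+1}, (2 ^ n <= #|S|)%N ->
        half 1 <= dens (\bigcup_(j in [set j | j \in S]) X (nat_of_ord j)) m].
Proof.
pose q := (2 ^ n).-1; have qE : (q.+1 = 2 ^ n)%N by rewrite prednK ?expn_gt0.
pose p := G.+1; pose m := (n * p)%N; pose T := {ffun 'I_p -> 'I_q.+1}.
have cT : #|{: T}| = (2 ^ m)%N by rewrite card_ffun !card_ord qE -expnM.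
pose e (s : T) := (2 ^ m + enum_rank s)%N.
pose V (S : {set T}) := [set i | exists2 s, s \in S & i = e s].
pose Av (S : {set 'I_p}) := [set s : T | [forall j in S, s j != ord0]]%SET.
have densC (S : {set 'I_p}) : dens (V (~: Av S)%SET) m = 1 - half m * #|Av S|%:R.
  have cAv : (2 ^ m)%:R = #|Av S|%:R + #|(~: Av S)%SET|%:R :> R.
    by rewrite -natrD cardsC cT.
  have h := half_nat R m; rewrite cAv mulrDr in h.
  by rewrite (_ : dens _ _ = half m * #|(~: Av S)%SET|%:R) ?dens_image//; lra.
have AvE (S : {set 'I_p}) :
    half m * #|Av S|%:R * (q.+1 ^ #|S|)%:R = (q ^ #|S|)%:R.
  rewrite -mulrA -natrM card_avoid_ord0 natrM qE -expnM -/m mulrCA half_nat.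
  by rewrite mulr1.
exists m, (fun j => V [set s : T | s (inord j) == ord0]%SET); split.
- by rewrite /m /p mulnS leq_addr.
- move=> j _ [s _ ->]; rewrite /e leq_addr /= expnS mul2n -addnn ltn_add2l.
  by rewrite -cT ltn_ord.
- move=> j jG; have -> : [set s : T | s (inord j) == ord0]%SET = (~: Av [set inord j])%SET.
    apply/setP => s; rewrite !inE; apply/idP/idP => [sj|].
      by apply/negP => /forallP/(_ (inord j)); rewrite inE eqxx sj.
    apply: contraR => sj; apply/forallP => i; apply/implyP.
    by rewrite inE => /eqP ->.
  have := AvE [set inord j]%SET; rewrite densC cards1 !expn1 => av.
  have hn : half n * (q%:R + 1) = 1 by rewrite natr1 qE half_nat.
  rewrite -natr1 in av.
  have qp : 0 < q%:R + 1 :> R by have := ler0n R q; lra.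
  rewrite -(ler_pM2r qp); lra.
- move=> S nS; apply: le_trans (_ : dens (V (~: Av S)%SET) m <= _); last first.
    apply: dens_le => _ _ [s + ->]; rewrite !inE => /forallPn[j].
    rewrite negb_imply negbK => /andP[jS sj].
    by exists j => //; exists s => //; rewrite inE inord_val.
  (* As [|S| > q], the probability [(q/(q+1))^|S|] of avoiding the value [0] on all of [S] is at
     most [1/2]. *)
  rewrite densC; have := AvE S.
  have := double_expn_le (q := q) (s := #|S|) ltac:(by rewrite qE).
  rewrite -(ler_nat R) natrM => h1 h2.
  have P0 : 0 < (q.+1 ^ #|S|)%:R :> R by rewrite ltr0n expn_gt0.
  have := half_nat R 1; rewrite expn1 => h3.
  have : half m * #|Av S|%:R <= half 1.
    by rewrite -(ler_pM2r P0) h2; nra.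
  by have := halfS R 0; rewrite half0; lra.
Qed.

Definition decode (j : nat) : set nat :=
  [set` odflt [::] (unpickle j : option (seq nat))].

Lemma decode_surj (A : set nat) : finite_set A -> exists j, decode j = A.
Proof. by move=> /finite_seqP[s ->]; exists (pickle s); rewrite /decode pickleK. Qed.

(** [D] is cut where its tails fall below [4^-n]; this bound leaves room for [2^n] candidates for
    the [n]-th chunk. *)
Lemma I_sum_chunks (w : nat -> R) D : (forall i, 0 <= w i) -> I_sum w D ->
  exists f : nat -> nat,
    (forall n N, wsum w (decode (f n)) N <= half (n + n)) /\
    forall n0, exists p, forall i, (p <= i)%N -> D i ->
      exists2 n, (n0 <= n)%N & decode (f n) i.
Proof.
move=> w0 ID; have [c cP] := ex_choice (fun n => I_sum_tail w0 (n + n) ID).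
pose t n := (\sum_(i < n.+1) (c i).+1)%N.
have tS : {homo t : m n / (m < n)%N}.
  apply: homo_ltn => [? ? ?|n]; first exact: ltn_trans.
  by rewrite /t [ltnRHS]big_ord_recr /=; lia.
have ct n : (c n <= t n)%N by rewrite /t big_ord_recr /=; lia.
have chunk n : finite_set (D `&` [set i | (t n <= i < t n.+1)%N]).
  by apply/finite_natP; exists (t n.+1) => i [_ /andP[]].
have [f fP] := ex_choice (fun n => decode_surj (chunk n)).
exists f; split=> [n N|n0].
  rewrite fP; apply: le_trans (cP n N); apply: wsum_le => // i _ [Di /andP[ti _]].
  by split => //=; apply: leq_trans ti.
exists (t n0) => i /(increasing_locate tS)[n n0n tin] Di.
by exists n => //; rewrite fP.
Qed.

(** The witness property is applied to the countably many unions of some [B n] with an initial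
    segment. *)
Lemma addw_mod_finite (w : nat -> R) AA (B : nat -> set nat) :
  (forall i, 0 <= w i) -> addw_wit (I_sum w) AA -> (forall n, I_sum w (B n)) ->
  exists2 A, AA A & forall n p, ~ (forall i, (p <= i)%N -> A i -> B n i).
Proof.
move=> w0 [_ addAA] IB; have [_ _ IU] := I_sum_ideal w0.
pose B' k := let: (n, p) := odflt (0, 0)%N (unpickle k) in
  B n `|` [set i | (i < p)%N].
have [|A AA_A nAB] := addAA B'.
  move=> k; rewrite /B'; case: (odflt _ _) => n p; apply: IU => //.
  exact/I_sum_Fin/finite_II.
exists A => // n p AB; apply: (nAB (pickle (n, p))); rewrite /B' pickleK /= => i Ai.
by have [pi|ip] := leqP p i; [left; exact: AB|right].
Qed.

(* If [g] dominates the codes [f] of the chunks, then [A f] picks from the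
   [n]-th family of independent blocks the one with index [f n]; a set of small
   density contains fewer than [2^n] of these. *)
Lemma addw_le_addw_sum (w : nat -> R) (I : set (set nat)) :
  (forall i, 0 <= w i) -> I_sum (@w1n R) `<=` I -> I `<=` I_d R ->
  mincard_le (addw_wit I) (addw_wit (I_sum w)).
Proof.
move=> w0 subI Isub AA addAA.
have [f fP] := choice_on (fun=> 0%N) (fun D => @I_sum_chunks w D w0).
(* If the codes are unbounded, the comparison with the unbounding number already gives a small
   witness; otherwise some [g] dominates them. *)
have [/(addw_le_b_density subI Isub)[E EI Ef]|] := pselect (b_wit (f @` AA)).
  by exists E => //; apply: card_le_trans Ef (card_image_le _ _).
move=> /dominating_increasing[g [gS gdom]].
have [m mP] := ex_choice (fun n => independent_blocks n (g n)).
have [X XP] := ex_choice mP.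
pose Y (D : set nat) n := [set i | (f D n < g n)%N /\ X n (f D n) i].
exists ((fun D => \bigcup_n Y D n) @` AA); last exact: card_image_le.
split.
  move=> _ [D _ <-]; apply: subI.
  apply: (@I_sum_bigcup _ _ (@w1n_ge0 R) _ 1) => // n N; rewrite mul1r.
  have [_ Xm Xh _] := XP n.
  have [fg|gf] := ltnP (f D n) (g n); last first.
    apply: le_trans (_ : wsum (@w1n R) set0 N <= _); last by rewrite wsum0 half_ge0.
    by apply: wsum_le => [i|i _ [/= ? _]]; [exact: w1n_ge0|lia].
  apply: le_trans (Xh _ (ltnW fg)); apply: le_trans (@wsum_w1n_block R _ _ N (Xm (f D n))).
  by apply: wsum_le => [i|i _ []//]; exact: w1n_ge0.
move=> B IB; apply: contrapT => noA.
have [n0 n0P] := ex_choice (fun l => (I_dP _ _).1 (Isub _ (IB l)) 2).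
(* [Z l n] unites the light chunks whose block lies in [B l]. There are fewer than [2^n] of them,
   each of weight at most [4^-n], so [Z l n] has weight at most [2^-n]. *)
pose J l n j := X n j `<=` B l /\ forall N, wsum w (decode j) N <= half (n + n).
pose Z l n := [set i | (n0 l <= n)%N /\ exists2 j, (j <= g n)%N & J l n j /\ decode j i].
have [|D AA_D nDB] := @addw_mod_finite w AA (fun l => \bigcup_n Z l n) w0 addAA.
  move=> l; apply: (@I_sum_bigcup _ _ w0 _ 1) => // n N; rewrite mul1r.
  have [nm _ _ Xlarge] := XP n.
  have [nn|nn] := leqP (n0 l) n; last first.
    apply: le_trans (_ : wsum w set0 N <= _); last by rewrite wsum0 half_ge0.
    by apply: wsum_le => // i _ [/= ? _]; lia.
  pose S := [set j : 'I_(g n).+1 | `[< J l n j >]]%SET.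
  have cS : (#|S| < 2 ^ n)%N.
    rewrite ltnNge; apply/negP => /Xlarge.
    have : dens (\bigcup_(j in [set j | j \in S]) X n (nat_of_ord j)) (m n) <= half 2.
      apply: le_trans (n0P l (m n) (leq_trans nn nm)).
      apply: dens_le => i _ [j /=]; rewrite inE => /asboolP[XB _]; exact: XB.
    by have := halfS R 1; have := half_gt0 R 2; lra.
  apply: le_trans (@wsum_bigcup _ _ w0 _
    (fun j => if `[< J l n j >] then decode j else set0) (g n).+1 N _) _.
    move=> i _ [_ [j jg [Jj ji]]]; exists j => //.
    by rewrite asboolT.
  apply: le_trans (_ : \sum_(j < (g n).+1) (j \in S)%:R * half (n + n) <= _).
    apply: ler_sum => j _; rewrite inE; case: asboolP => [[_ ?]|_].
      by rewrite mul1r.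
    by rewrite mul0r wsum0.
  rewrite -mulr_suml -natr_sum -big_mkcondr /= sum1_card halfD mulrA.
  rewrite -[leRHS]mul1r ler_wpM2r ?half_ge0//.
  by rewrite -[leRHS](half_nat R n) mulrC ler_wpM2l ?half_ge0// ler_nat ltnW.
apply: noA; exists (\bigcup_n Y D n); first by exists D.
move=> l AB.
have [N Nfg] : exists N, forall n, (N <= n)%N -> (f D n < g n)%N.
  by apply: gdom; exists D.
have [fsmall fcov] := fP D (addAA.1 D AA_D).
have [p pP] := fcov (maxn N (n0 l)).
apply: (nDB l p) => i pi Di; have [n nn fi] := pP i pi Di.
have fg := Nfg n (leq_trans (leq_maxl _ _) nn).
exists n => //; split; first exact: leq_trans (leq_maxr _ _) nn.
exists (f D n); first exact: ltnW.
by split => //; split => // i' Xi'; apply: AB; exists n.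
Qed.

(** All codes of stage [n] weigh [2^-(n+1)], so a set of finite weight contains only [O(2^n)] of
    them. The exponent is kept positive for the comparison with null sets. *)
Definition w_pair (k : nat) : R :=
  half (if (unpickle k : option (nat * nat)) is Some (n, j) then n.+1 else 1).

Lemma w_pair_ge0 k : 0 <= w_pair k.
Proof. exact: half_ge0. Qed.

Lemma w_pairE (n j : nat) : w_pair (pickle (n, j)) = half n.+1.
Proof. by rewrite /w_pair pickleK. Qed.

Lemma sum_w_pair (n K : nat) (B : set nat) : exists N,
  \sum_(j < K) (pickle (n, nat_of_ord j) \in B)%:R * half n.+1 <= wsum w_pair B N.
Proof.
pose X (j : nat) := if pickle (n, j) \in B then [set pickle (n, j)] else set0.
exists (\max_(j < K) pickle (n, nat_of_ord j)).+1.
apply: le_trans (_ : \sum_(j < K) wsum w_pair (X j) _ <= _); last first.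
  apply: (sum_wsum_disjoint w_pair_ge0).
    by move=> j; rewrite /X; case: ifPn => [/set_mem ? _ ->|_ ?].
  move=> i j ij; rewrite /X; case: ifPn => _; last by rewrite set0I.
  case: ifPn => _; last by rewrite setI0.
  rewrite -subset0 => x [/= -> ] /(pcan_inj pickleK)[]; exact: ij.
apply: ler_sum => j _; rewrite /X; case: ifPn => _; last by rewrite mul0r wsum0.
rewrite mul1r -(w_pairE n j); apply: wsum_ge1 => //; first exact: w_pair_ge0.
by rewrite ltnS; exact: (@bigmax_ord_sup (fun j => pickle (n, j))).
Qed.

(* Once [g] dominates the points beyond which [A] has density [<= 4^-n], the
   set [A] is coded by its traces on the intervals [2^(g n), 2^(g (n+1))), and a
   summable set of codes contains only [O(2^n)] candidates for the [n]-th one. *)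
Lemma addw_sum_le_addw_I_d (X : Type) (P : set X -> Prop) :
  mincard_le P b_wit -> mincard_le P (addw_wit (I_sum w_pair)) ->
  mincard_le P (addw_wit (I_d R)).
Proof.
move=> Pb Psum AA addAA.
have [f fP] := choice_on (fun=> 0%N) (fun A (IA : I_d R A) =>
  ex_choice (fun n => (I_dP R A).1 IA (n + n)%N)).
have [/Pb[E PE Ef]|] := pselect (b_wit (f @` AA)).
  by exists E => //; apply: card_le_trans Ef (card_image_le _ _).
move=> /dominating_increasing[g [gS gdom]].
pose W n := [set i | (2 ^ g n <= i < 2 ^ g n.+1)%N].
have trace (A : set nat) n : finite_set (A `&` W n).
  by apply/finite_natP; exists (2 ^ g n.+1)%N => i [_ /andP[]].
have [F FP] := ex_choice (fun A => ex_choice (fun n => decode_surj (trace A n))).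
pose D A := \bigcup_n [set pickle (n, F A n)].
suff /Psum[E PE EF] : addw_wit (I_sum w_pair) (D @` AA).
  by exists E => //; apply: card_le_trans EF (card_image_le _ _).
split.
  move=> _ [A _ <-]; apply: (@I_sum_bigcup _ _ w_pair_ge0 _ 1) => // n N.
  apply: le_trans (wsum1 w_pair_ge0 _ _) _.
  by rewrite mul1r w_pairE half_le.
move=> B IB; apply: contrapT => noD.
pose Q l n j := [/\ B l (pickle (n, j)), decode j `<=` W n &
  forall m, (g n <= m)%N -> dens (decode j) m <= half (n + n)].
pose A' l := \bigcup_n \bigcup_(j in [set j | Q l n j]) decode j.
have IA' l : I_d R (A' l).
  have [M MB] := IB l.
  have M0 : 0 <= M by apply: le_trans (MB 0%N); apply: wsum_ge0; exact: w_pair_ge0.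
  have densA' n m : (g n <= m < g n.+1)%N -> dens (A' l) m <= 2 * M * half n.
    move=> gm.
    have A'n i : (2 ^ m <= i < 2 ^ m.+1)%N -> A' l i ->
        exists2 j, Q l n j & decode j i.
      move=> im [n' _ [j Qj ji]]; exists j => //.
      suff -> : n = n' by [].
      have [_ /(_ i ji) /= /andP[gi ig] _] := Qj.
      have : (2 ^ g n <= 2 ^ m)%N by rewrite leq_exp2l//; case/andP: gm.
      have : (2 ^ m.+1 <= 2 ^ g n.+1)%N by rewrite leq_exp2l//; case/andP: gm.
      move=> h1 h2; have h3 : (2 ^ g n < 2 ^ g n'.+1)%N by lia.
      have h4 : (2 ^ g n' < 2 ^ g n.+1)%N by lia.
      move: h3 h4; rewrite !ltn_exp2l// => h3 h4.
      apply/eqP; rewrite eqn_leq; apply/andP; split; rewrite -ltnS ltnNge;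
      by apply/negP => /(increasing_leq gS); lia.
    have [nu nuP] := @choice_on _ _ 0%N
      [set i | (2 ^ m <= i < 2 ^ m.+1)%N /\ A' l i]
      (fun i j => Q l n j /\ decode j i) (fun i '(conj im Ai) =>
      let: ex_intro2 j Qj ji := A'n i im Ai in ex_intro _ j (conj Qj ji)).
    pose K := (\max_(i < 2 ^ m.+1) nu i).+1.
    pose Z j := if `[< Q l n j >] then decode j else set0.
    apply: le_trans (_ : dens (A' l `&` [set i | (2 ^ m <= i)%N]) m <= _).
      by apply: dens_le => i /andP[? _] ?; split.
    apply: le_trans (@wsum_bigcup _ _ (@wblock_ge0 R m) _ Z K _ _) _.
      move=> i im [A'i mi]; have [|Qi di] := nuP i; first by split => //; apply/andP.
      by exists (nu i); [rewrite ltnS; exact: bigmax_ord_sup|rewrite /Z asboolT].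
    apply: le_trans (_ : \sum_(j < K)
        (pickle (n, nat_of_ord j) \in B l)%:R * half (n + n) <= _).
      apply: ler_sum => j _; rewrite /Z; case: asboolP => [[Bj _ dj]|_].
        by rewrite mem_set// mul1r dj//; case/andP: gm.
      by rewrite wsum0 mulr_ge0 ?half_ge0.
    have [N NP] := sum_w_pair n K (B l).
    have := le_trans NP (MB N).
    rewrite -!mulr_suml halfD (halfS R n) => h.
    have := half_ge0 R n.+1; nra.
  apply/I_dP => n.
  have [n1 n1P] := half_small (divr_gt0 (half_gt0 R n)
    (ltac:(lra) : 0 < 2 * M + 1)).
  exists (g n1) => m /(increasing_locate gS)[n' n1n' /densA']; move/le_trans; apply.
  apply: le_trans (_ : (2 * M + 1) * half n1 <= _); last first.
    by rewrite mulrC -ler_pdivlMr ?ltW//; lra.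
  have := half_le R n1n'; have := half_ge0 R n'; nra.
(* The test sequence is indexed by pairs [(l, p)], so that the part of [A] below [2^(g N)] can be
   disregarded. *)
have [A AA_A nAA'] := addAA.2
  (fun k => let: (l, p) := odflt (0, 0)%N (unpickle k) in
     A' l `|` [set i | (i < p)%N])
  (fun k => let: (l, p) as lp := odflt (0, 0)%N (unpickle k) return
     I_d R (let: (l, p) := lp in A' l `|` [set i | (i < p)%N]) in
   let: And3 _ _ IU := I_d_ideal R in IU _ _ (IA' l) (I_d_Fin (finite_II p))).
apply: noD; exists (D A); first by exists A.
move=> l DB.
have [N Nfg] : exists N, forall n, (N <= n)%N -> (f A n < g n)%N.
  by apply: gdom; exists A.
apply: (nAA' (pickle (l, (2 ^ g N)%N))); rewrite pickleK /= => i Ai.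
have [Ni|iN] := leqP (2 ^ g N) i; last by right.
have gS2 : {homo (fun n => 2 ^ g n)%N : m n / (m < n)%N}.
  by move=> a b ab; rewrite ltn_exp2l// gS.
have [n Nn ni] := increasing_locate gS2 Ni.
left; exists n => //; exists (F A n); last by rewrite FP.
split; first by apply: DB; exists n.
  by rewrite FP; exact: subIsetr.
move=> m gm; rewrite FP; apply: le_trans (_ : dens A m <= _).
  by apply: dens_le => ? _ [].
apply: fP; first exact: addAA.1.
exact: leq_trans (ltnW (Nfg n Nn)) gm.
Qed.

End SumReduction.

(** * Null sets *)

(** The outer measure gives countable subadditivity for arbitrary sets, without measurability
    conditions. *)
Definition outer_leb (R : realType) :
  {outer_measure set (ocitv_type R) -> \bar R} := (wlength (@idfun R))^*%mu.

Section Measure.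
Variable R : realType.
Local Notation half := (half R).
Local Notation mu := (outer_leb R).

Lemma null_outer_leb (A : set R) : @Defs.null_set R A <-> mu A = 0%E.
Proof. exact: negligible_outer_measure. Qed.

Lemma outer_leb_itv (a b : R) : a <= b -> mu [set x | a <= x < b] = (b - a)%:E.
Proof.
move=> ab; have -> : [set x | a <= x < b] = `[a, b[%classic.
  by apply/seteqP; split=> x /=; rewrite in_itv.
rewrite -[LHS]/(lebesgue_measure (`[a, b[%classic : set R)).
rewrite lebesgue_measure_itv /= lte_fin.
case: ltP => [_//|ba].
by rewrite (le_anti (introT andP (conj ab ba))) subrr.
Qed.

Lemma outer_leb_bigcup_le (F : nat -> set R) K (c : nat -> R) :
  (forall b, (b < K)%N -> (mu (F b) <= (c b)%:E)%E) ->
  (mu (\bigcup_(b < K) F b) <= (\sum_(b < K) c b)%:E)%E.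
Proof.
rewrite bigcup_mkord; elim: K => [|K IHK] Fc.
  by rewrite !big_ord0 outer_measure0.
rewrite !big_ord_recr /= EFinD; apply: le_trans (outer_measureU2 _ _ _) _.
by rewrite leeD// ?Fc// IHK// => b bK; apply: Fc; exact: leqW.
Qed.

Lemma outer_leb_bigcup0 (F : nat -> set R) K :
  (forall b, (b < K)%N -> mu (F b) = 0%E) -> mu (\bigcup_(b < K) F b) = 0%E.
Proof.
move=> F0; apply/eqP; rewrite eq_le outer_measure_ge0 andbT.
have := @outer_leb_bigcup_le F K (fun=> 0).
by rewrite big1//; apply => b /F0 ->.
Qed.

Definition limsup_along (F : nat -> set R) (D : set nat) :=
  [set x | forall m, exists2 i, (m <= i)%N & D i /\ F i x].

(** The first Borel-Cantelli lemma: the limsup is covered by the [F i] with [i] in a tail of [D],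
    whose weight is arbitrarily small. *)
Lemma limsup_along_null (w : nat -> R) (F : nat -> set R) (C : R) D :
  (forall i, 0 <= w i) -> 0 <= C -> I_sum w D ->
  (forall i, (mu (F i) <= (C * w i)%:E)%E) -> mu (limsup_along F D) = 0%E.
Proof.
move=> w0 C0 ID Fw; apply/eqP; rewrite eq_le outer_measure_ge0 andbT.
apply/lee_addgt0Pr => e e0; rewrite add0e.
have [n ne] := half_small (divr_gt0 e0 (ltac:(lra) : 0 < C + 1)).
have [c cP] := I_sum_tail w0 n ID.
pose D' := D `&` [set i | (c <= i)%N].
pose F' i := if i \in D' then F i else set0.
apply: le_trans (_ : mu (\bigcup_i F' i) <= _)%E.
  apply: le_outer_measure => x /(_ c)[i ci [Di Fi]]; exists i => //.
  by rewrite /F' mem_set.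
apply: le_trans (outer_measure_sigma_subadditive mu F') _.
apply: lime_le; first by apply: is_cvg_nneseries => i _ _; exact: outer_measure_ge0.
apply: nearW => N; apply: le_trans (_ : (C * wsum w D' N)%:E <= _)%E.
  rewrite /wsum mulr_sumr -sumEFin big_mkord; apply: lee_sum => i _; rewrite /F'.
  by case: ifPn => _; rewrite ?mul1r// mul0r mulr0 outer_measure0.
rewrite lee_fin; have := cP N; rewrite -/D' => D'n.
have : half n * (C + 1) < e by rewrite -ltr_pdivlMr//; lra.
have := half_ge0 R n; have := wsum_ge0 w0 D' N; nra.
Qed.

(** * Independent events on groups of binary digits *)

Section NullToSummable.
Variable k : nat -> nat.
Hypothesis k_gt0 : forall i, (0 < k i)%N.
Local Notation w := (fun i => half (k i)).

Let w_ge0 i : 0 <= w i. Proof. exact: half_ge0. Qed.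

(** The binary digits are grouped: the [n]-th group has [k n] digits, preceded by [level n]
    digits. *)
Definition level n := (\sum_(i < n) k i)%N.

Lemma levelS n : level n.+1 = (level n + k n)%N.
Proof. by rewrite /level big_ord_recr. Qed.

Lemma level_increasing : {homo level : m n / (m < n)%N}.
Proof.
by apply: homo_ltn => [? ? ?|n]; [exact: ltn_trans|rewrite levelS; have := k_gt0 n; lia].
Qed.

Definition dyadic l a : set R := [set x | a%:R * half l <= x < a.+1%:R * half l].

Lemma dyadic_measure l a : mu (dyadic l a) = (half l)%:E.
Proof.
rewrite outer_leb_itv; last by rewrite ler_wpM2r ?half_ge0// ler_nat.
by rewrite -mulrBl -natr1 addrAC subrr add0r mul1r.
Qed.

Lemma dyadic_half l d c : c%:R * half (l + d) * (2 ^ d)%:R = c%:R * half l.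
Proof. by rewrite halfD -!mulrA half_nat mulr1. Qed.

Lemma dyadic_nested l d a c x : dyadic l a x -> dyadic (l + d) c x ->
  (a * 2 ^ d <= c < a.+1 * 2 ^ d)%N.
Proof.
move=> /andP[ax xa] /andP[cx xc].
have P0 : 0 < (2 ^ d)%:R :> R by rewrite ltr0n expn_gt0.
have H0 := half_gt0 R (l + d).
have E b : b%:R * half l = (b * 2 ^ d)%:R * half (l + d).
  by rewrite -(dyadic_half l d) natrM mulrAC.
rewrite !E in ax xa.
have : (a * 2 ^ d)%:R < c.+1%:R :> R.
  by rewrite -(ltr_pM2r H0); exact: le_lt_trans ax xc.
have : c%:R < (a.+1 * 2 ^ d)%:R :> R.
  by rewrite -(ltr_pM2r H0); exact: le_lt_trans cx xa.
by rewrite !ltr_nat; lia.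
Qed.

Lemma dyadic_sub l d a c :
  (a * 2 ^ d <= c < a.+1 * 2 ^ d)%N -> dyadic (l + d) c `<=` dyadic l a.
Proof.
move=> /andP[ac ca] x /andP[cx xc].
have E b : b%:R * half l = (b * 2 ^ d)%:R * half (l + d).
  by rewrite -(dyadic_half l d) natrM mulrAC.
rewrite /dyadic /= !E (le_trans _ cx) ?ler_wpM2r ?half_ge0 ?ler_nat//=.
by rewrite (lt_le_trans xc)// ler_wpM2r ?half_ge0 ?ler_nat.
Qed.

Lemma dyadic_inj l a c x : dyadic l a x -> dyadic l c x -> a = c.
Proof.
rewrite -{2}[l]addn0 => ax cx; have := dyadic_nested ax cx.
by rewrite expn0 !muln1; lia.
Qed.

Lemma dyadic_split l d a x : dyadic l a x ->
  exists2 b, (b < 2 ^ d)%N & dyadic (l + d) (a * 2 ^ d + b) x.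
Proof.
move=> ax; have x0 : 0 <= x.
  by case/andP: ax => + _; apply: le_trans; rewrite mulr_ge0 ?half_ge0.
have H0 := half_gt0 R (l + d).
have cx : dyadic (l + d) (Num.truncn (x / half (l + d))) x.
  have := truncn_itv (divr_ge0 x0 (ltW H0)).
  by rewrite ler_pdivlMr// ltr_pdivrMr.
have /andP[ac ca] := dyadic_nested ax cx.
exists (Num.truncn (x / half (l + d)) - a * 2 ^ d)%N; last by rewrite subnKC.
by rewrite ltn_subLR// -mulSnr.
Qed.

(** The points of [[0, 1)] whose [i]-th group of digits is zero: independent events of measure
    [2^-(k i)]. *)
Definition digits0 i : set R :=
  \bigcup_(c < 2 ^ level i) dyadic (level i.+1) (c * 2 ^ k i).

Lemma digits0_measure i : (mu (digits0 i) <= (w i)%:E)%E.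
Proof.
apply: le_trans (@outer_leb_bigcup_le _ _ (fun=> half (level i.+1)) _) _.
  by move=> b _; rewrite dyadic_measure.
rewrite lee_fin sumr_const card_ord -mulr_natr levelS halfD mulrAC half_nat.
by rewrite mul1r.
Qed.

Lemma digits0_dyadic n a b x : (b < 2 ^ k n)%N ->
  (a < 2 ^ level n)%N ->
  dyadic (level n.+1) (a * 2 ^ k n + b) x -> digits0 n x <-> b = 0%N.
Proof.
move=> bk al bx; split=> [[c _ cx]|b0].
  have := dyadic_inj bx cx; have [ca|ac] := leqP c a.
    by have := leq_mul ca (leqnn (2 ^ k n)); lia.
  by have := leq_mul ac (leqnn (2 ^ k n)); rewrite mulSn; lia.
by exists a => //=; rewrite b0 addn0 in bx.
Qed.

Definition avoid (B : set nat) n d : set R :=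
  [set x | forall i, (n <= i < n + d)%N -> B i -> ~ digits0 i x].

(** The relative measure that independence predicts for [avoid B n d] inside a dyadic interval of
    level [level n]. *)
Definition avoid_mass (B : set nat) n d : R :=
  \prod_(i < d) (1 - ((n + i)%N \in B)%:R * w (n + i)%N).

Lemma avoid_massS B n d : avoid_mass B n d.+1 =
  (1 - (n \in B)%:R * w n) * avoid_mass B n.+1 d.
Proof.
rewrite /avoid_mass big_ord_recl addn0; congr (_ * _).
by apply: eq_bigr => i _; rewrite lift0 addnS.
Qed.

Lemma avoid_term_ge0 (B : set nat) i : 0 <= 1 - (i \in B)%:R * w i.
Proof.
have := half_le1 R (k i); have := half_ge0 R (k i).
by case: (_ \in _); rewrite ?mul1r ?mul0r; lra.
Qed.

(** Induction on [d]: the interval splits into [2^(k n)] equal parts, and if [n] is in [B] the part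
    with zero digits is discarded. *)
Lemma avoid_measure B d n a : (a < 2 ^ level n)%N ->
  (mu (dyadic (level n) a `&` avoid B n d)
     <= (half (level n) * avoid_mass B n d)%:E)%E.
Proof.
elim: d n a => [|d IHd] n a al.
  rewrite /avoid_mass big_ord0 mulr1 -(dyadic_measure (level n) a).
  by apply: le_outer_measure => x [].
pose c b := if (n \in B) && (b == 0)%N then 0
            else half (level n.+1) * avoid_mass B n.+1 d.
apply: le_trans (_ : mu (\bigcup_(b < 2 ^ k n)
    (if (n \in B) && (b == 0)%N then set0 else
     dyadic (level n.+1) (a * 2 ^ k n + b) `&` avoid B n.+1 d)) <= _)%E.
  apply: le_outer_measure => x [ax avx].
  have [b bk bx] := dyadic_split (k n) ax; rewrite -levelS in bx.
  exists b => //; case: ifPn => [/andP[/set_mem Bn /eqP b0]|_]; last first.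
    split => // i /andP[ni id]; apply: avx; lia.
  case: (avx n _ Bn); first lia.
  exact/(digits0_dyadic bk al bx).
apply: le_trans (@outer_leb_bigcup_le _ _ c _) _.
  move=> b bk; rewrite /c; case: ifP => _; first by rewrite outer_measure0.
  apply: IHd; rewrite levelS expnD; nia.
rewrite lee_fin /c avoid_massS -(prednK (expn_gt0 2 (k n))) big_ord_recl /= andbT.
under eq_bigr do rewrite andbF.
rewrite sumr_const card_ord levelS halfD -[X in _ + X]mulr_natr.
have := half_nat R (k n); rewrite -{1}(prednK (expn_gt0 2 (k n))) -natr1.
set t := ((2 ^ k n).-1)%:R; set h := half (level n); set q := avoid_mass _ _ _.
move=> kt; have -> : h * half (k n) * q * t = h * q * (half (k n) * t).
  by rewrite -!mulrA (mulrCA (half (k n))).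
have -> : half (k n) * t = 1 - half (k n) by lra.
by case: (n \in B); rewrite ?mul1r ?mul0r; lra.
Qed.

Lemma avoid_mass_ge0 B n d : 0 <= avoid_mass B n d.
Proof. by apply: prodr_ge0 => i _; exact: avoid_term_ge0. Qed.

(** The product of the [1 - x_i] is at most [1 / (1 + S)], with [S] the sum of the [x_i], in a form
    without division. *)
Lemma avoid_mass_sum B n d :
  avoid_mass B n d * (1 + \sum_(i < d) ((n + i)%N \in B)%:R * w (n + i)%N) <= 1.
Proof.
elim: d => [|d IHd]; first by rewrite /avoid_mass !big_ord0; lra.
rewrite /avoid_mass !big_ord_recr /= -/(avoid_mass B n d).
set S := \sum_(i < d) _ in IHd *; set P := avoid_mass B n d in IHd *.
have S0 : 0 <= S by apply: sumr_ge0 => i _; rewrite mulr_ge0.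
have P0 : 0 <= P := avoid_mass_ge0 B n d.
have x0 := avoid_term_ge0 B (n + d).
have y0 : 0 <= ((n + d)%N \in B)%:R * w (n + d)%N by rewrite mulr_ge0.
move: x0 y0; set y := _%:R * _ => x0 y0.
have -> : P * (1 - y) * (1 + (S + y)) = P * (1 + S) - P * (y * y + y * S).
  by rewrite !(mulrBr, mulrDr, mulrBl, mulrDl, mulr1, mul1r, mulrA); lra.
by rewrite (le_trans _ IHd)// lerBlDr lerDl mulr_ge0// addr_ge0// mulr_ge0.
Qed.

Variable O : set R.

Definition missed n a : set nat := [set i | (n <= i)%N /\
  mu ((dyadic (level n) a `&` digits0 i) `\` O) = 0%E].

(* The events [digits0 i] are independent: if infinitely much mass of them could
   be avoided inside [O^c], nothing of [O^c] would remain. *)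
Lemma missed_summable n a : (a < 2 ^ level n)%N ->
  mu (dyadic (level n) a `\` O) <> 0%E -> I_sum w (missed n a).
Proof.
move=> al nz; set B := missed n a.
have fin : (mu (dyadic (level n) a `\` O) <= 1%:E)%E.
  apply: le_trans (_ : mu (dyadic (level n) a) <= _)%E.
    by apply: le_outer_measure => x [].
  by rewrite dyadic_measure lee_fin half_le1.
have [c c0 cE] : exists2 c : R, 0 < c & mu (dyadic (level n) a `\` O) = c%:E.
  move: nz fin; have := outer_measure_ge0 mu (dyadic (level n) a `\` O).
  case: (mu _) => // c; rewrite lee_fin => c0 c1 _; exists c => //.
  by rewrite lt_neqAle c0 andbT; apply/eqP => c00; apply: c1; rewrite -c00.
(* Up to a null set, the part of the interval outside [O] avoids all events indexed by [B], so its
   measure bounds every avoidance mass from below. *)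
have mass d : c <= avoid_mass B n d.
  rewrite -lee_fin -cE.
  pose F b := if (n + b)%N \in B then
    (dyadic (level n) a `&` digits0 (n + b)) `\` O else set0.
  apply: le_trans (_ : mu ((dyadic (level n) a `&` avoid B n d) `|`
      \bigcup_(b < d) F b) <= _)%E.
    apply: le_outer_measure => x [ax nOx].
    have [?|navx] := pselect (avoid B n d x); [by left|right].
    have /existsNP[i /not_implyP[ni /not_implyP[Bi /contrapT ix]]] := navx.
    exists (i - n)%N; first by move=> /=; lia.
    rewrite /F subnKC; last lia.
    by rewrite mem_set.
  apply: le_trans (outer_measureU2 _ _ _) _.
  rewrite outer_leb_bigcup0 ?adde0; last first.
    move=> b _; rewrite /F; case: ifPn => [/set_mem[]//|_].
    exact: outer_measure0.
  apply: le_trans (avoid_measure _ _ al) _; rewrite lee_fin.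
  by rewrite ler_piMl ?avoid_mass_ge0// half_le1.
exists c^-1 => N; rewrite -[leRHS]mul1r ler_pdivlMr//.
apply: le_trans (avoid_mass_sum B n N).
apply: le_trans (_ : (\sum_(i < N) ((n + i)%N \in B)%:R * w (n + i)%N) * c <= _).
  apply: ler_wpM2r; first exact: ltW.
  apply: le_trans (@wsum_homo _ _ w_ge0 _ N (n + N) (leq_addl _ _)) _.
  rewrite /wsum big_split_ord /= big1 ?add0r// => i _.
  by rewrite memNset ?mul0r// => -[]; have := ltn_ord i; lia.
have := mass N; set S := \sum_(i < N) _ => cm.
have S0 : 0 <= S by apply: sumr_ge0 => i _; rewrite mulr_ge0.
nra.
Qed.

Hypothesis O_open : open O.
Hypothesis O_small : mu (dyadic 0 0 `\` O) <> 0%E.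

(* Otherwise one finds a decreasing sequence of dyadic intervals, none of them
   contained in [O], through ever later events [digits0 i] with [i] in [A]; their
   common point lies in the limsup but not in [O]. *)
Lemma limsup_sub_missed A : limsup_along digits0 A `<=` O ->
  exists na : nat * nat, [/\ (na.2 < 2 ^ level na.1)%N,
    mu (dyadic (level na.1) na.2 `\` O) <> 0%E &
    exists p, forall i, (p <= i)%N -> A i -> missed na.1 na.2 i].
Proof.
move=> AO; apply: contrapT => nomiss.
pose good (na : nat * nat) := (na.2 < 2 ^ level na.1)%N /\
    mu (dyadic (level na.1) na.2 `\` O) <> 0%E.
pose nxt (na ic : nat * nat) := [/\ (na.1 <= ic.1)%N, A ic.1,
  (na.2 * 2 ^ (level ic.1 - level na.1) <= ic.2 <
    na.2.+1 * 2 ^ (level ic.1 - level na.1))%N, (ic.2 < 2 ^ level ic.1)%N &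
  good (ic.1.+1, (ic.2 * 2 ^ k ic.1)%N)].
(* If no step were possible, [digits0 i] would meet the interval only inside [O], up to a null set,
   for every [i >= n] in [A], against [nomiss]. *)
have ex_next na : good na -> exists ic, nxt na ic.
  case: na => n a [/= al nz]; apply: contrapT => nonext.
  apply: nomiss; exists (n, a); split => //=; exists n => i ni Ai; split => //.
  pose F c := if `[< dyadic (level i.+1) (c * 2 ^ k i) `&` dyadic (level n) a !=set0 >]
    then dyadic (level i.+1) (c * 2 ^ k i) `\` O else set0.
  apply/eqP; rewrite eq_le outer_measure_ge0 andbT.
  apply: le_trans (_ : mu (\bigcup_(c < 2 ^ level i) F c) <= _)%E.
    apply: le_outer_measure => x [[ax [c ci cx]] nOx]; exists c => //.
    by rewrite /F asboolT//; exists x.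
  rewrite outer_leb_bigcup0// => c ci; rewrite /F; case: asboolP; last first.
    by rewrite outer_measure0.
  move=> [x [cx ax]]; apply: contrapT => cnz; apply: nonext; exists (i, c).
  have lni := increasing_leq level_increasing ni.
  split=> //=.
    apply: (dyadic_nested ax (x := x)); rewrite subnKC//.
    rewrite levelS in cx; apply: dyadic_sub cx.
    by rewrite leqnn /= ltn_pmul2r ?expn_gt0.
  by split => //=; rewrite levelS expnD ltn_pmul2r ?expn_gt0.
have [f fP] := choice_on (0, 0)%N ex_next.
pose step na := let ic := f na in (ic.1.+1, (ic.2 * 2 ^ k ic.1)%N).
pose z j := iter j step (0, 0)%N.
have z_good j : good (z j).
  elim: j => [|j /fP[]//].
  by rewrite /good /= (_ : level 0 = 0%N) // /level big_ord0.
have zP j : nxt (z j) (f (z j)) by apply: fP.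
pose lft j : R := (z j).2%:R * half (level (z j).1).
pose rgt j : R := (z j).2.+1%:R * half (level (z j).1).
have lr j : lft j < rgt j by rewrite ltr_pM2r ?half_gt0// ltr_nat.
(* The right endpoints decrease strictly because [k i > 0]; this keeps the supremum of the left
   endpoints inside the half-open intervals. *)
have sub j : lft j <= lft j.+1 /\ rgt j.+1 < rgt j.
  have [ni _ /andP[ac ca] _ _] := zP j.
  have lni := increasing_leq level_increasing ni.
  set n := (z j).1 in ni lni ac ca; set a := (z j).2 in ac ca.
  set i := (f (z j)).1 in ni lni ac ca; set c := (f (z j)).2 in ac ca.
  have E b : b%:R * half (level n) = (b * 2 ^ (level i - level n) * 2 ^ k i)%:R *
      half (level i.+1).
    have := dyadic_half (level n) (level i - level n) b; rewrite subnKC// => <-.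
    by rewrite levelS natrM [RHS]mulrAC dyadic_half natrM mulrAC.
  rewrite /lft /rgt /= -/n -/a -/i -/c !E; split.
    by rewrite ler_pM2r ?half_gt0// ler_nat leq_mul2r ac orbT.
  rewrite ltr_pM2r ?half_gt0// ltr_nat.
  have k1 : (1 < 2 ^ k i)%N by rewrite -[X in (X < _)%N](expn0 2) ltn_exp2l.
  by apply: leq_trans (_ : c.+1 * 2 ^ k i <= _)%N;
    [rewrite mulSn; lia|rewrite leq_mul2r ca orbT].
have lft_mono i j : (i <= j)%N -> lft i <= lft j.
  elim: j => [|j IHj]; first by rewrite leqn0 => /eqP ->.
  rewrite leq_eqVlt => /orP[/eqP ->//|]; rewrite ltnS => /IHj/le_trans; apply.
  by case: (sub j).
have rgt_mono i j : (i <= j)%N -> rgt j <= rgt i.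
  elim: j => [|j IHj]; first by rewrite leqn0 => /eqP ->.
  rewrite leq_eqVlt => /orP[/eqP ->//|]; rewrite ltnS => /IHj; apply: le_trans.
  by case: (sub j) => _ /ltW.
have lft_rgt i j : lft i <= rgt j.
  by have [/lft_mono/le_trans|/ltnW/rgt_mono] := leqP i j; [apply; exact: ltW|apply: le_trans; exact: ltW].
pose x := sup [set lft j | j in [set: nat]].
have lft_x j : lft j <= x.
  by apply: ub_le_sup; [exists (rgt 0) => _ [i _ <-]|exists j].
have x_rgt j : x < rgt j.
  apply: le_lt_trans (proj2 (sub j)); apply: ge_sup; first by exists (lft 0), 0%N.
  by move=> _ [i _ <-].
have level_z j : (j <= (z j).1)%N.
  elim: j => [//|j IHj]; have [ni _ _ _ _] := zP j.
  by rewrite /z /= -/(z j) ltnS (leq_trans IHj).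
have Ox : O x.
  apply: AO => m; have [ni Ai _ ci _] := zP m.
  exists (f (z m)).1; first exact: leq_trans ni.
  split => //; exists (f (z m)).2 => //.
  by have := lft_x m.+1; have := x_rgt m.+1; rewrite /lft /rgt /z /= /dyadic /= => -> ->.
(* [O] is open, so a sufficiently short interval of the sequence lies inside [O], although its part
   outside [O] is not null. *)
have [e /= e0 eO] := (nbhs_ballP x O).1 (open_nbhs_nbhs (conj O_open Ox)).
have [j je] := half_small e0.
have [_ []] := z_good j.
rewrite (_ : _ `\` O = set0) ?outer_measure0// -subset0 => y [/andP[ly yr] nOy].
apply: nOy; apply: eO; rewrite /ball /= ltr_distl.
have hj : half (level (z j).1) <= half j.
  apply: half_le; apply: leq_trans (level_z j) _; exact: increasing_ge_id level_increasing.
have := lft_x j; have := x_rgt j; move: ly yr; rewrite /lft /rgt -natr1 mulrDl mul1r.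
by move=> *; apply/andP; split; lra.
Qed.

End NullToSummable.

Lemma addN_le_addw_sum (k : nat -> nat) : (forall i, (0 < k i)%N) ->
  mincard_le (@addN_wit R) (addw_wit (I_sum (fun i => half (k i)))).
Proof.
move=> k0; have w0 i : 0 <= half (k i) by exact: half_ge0.
apply: mincard_le_image => AA addAA; exists (limsup_along (digits0 k)); split.
  move=> _ [A /addAA.1 IA <-]; apply/null_outer_leb.
  apply: (@limsup_along_null _ _ 1 A w0) => // i.
  by rewrite mul1r; exact: digits0_measure.
move=> [Z [mZ Z0 GZ]].
have Zfin : (lebesgue_measure Z < +oo)%E by rewrite Z0 ltry.
have [V [oV ZV VZ]] := lebesgue_regularity_outer mZ Zfin (ltr01 : 0 < 1 :> R).
have muV : (mu V < 1%:E)%E.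
  apply: le_lt_trans (_ : mu (Z `|` (V `\` Z)) < _)%E.
    by apply: le_outer_measure => x Vx; have [|] := pselect (Z x); [left|right].
  apply: le_lt_trans (outer_measureU2 _ _ _) _.
  by rewrite -[X in (X + _)%E]/(lebesgue_measure Z) Z0 add0e.
have V_small : mu (dyadic 0 0 `\` V) <> 0%E.
  move=> D0; have := dyadic_measure 0 0; rewrite half0 => D1.
  have : (1%:E <= mu V)%E.
    rewrite -D1; apply: le_trans (_ : mu ((dyadic 0 0 `\` V) `|` V) <= _)%E.
      by apply: le_outer_measure => x Dx; have [|] := pselect (V x); [right|left].
    by apply: le_trans (outer_measureU2 _ _ _) _; rewrite D0 add0e.
  by rewrite leNgt muV.
pose ok (na : nat * nat) := (na.2 < 2 ^ level k na.1)%N /\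
  mu (dyadic (level k na.1) na.2 `\` V) <> 0%E.
(* Only intervals not almost contained in [V] have summable [missed] sets; every other code is given
   the empty set. *)
pose B l := let na := odflt (0, 0)%N (unpickle l) in
  if `[< ok na >] then missed k V na.1 na.2 else set0.
have [|A AA_A nAB] := addw_mod_finite (B := B) w0 addAA.
  move=> l; rewrite /B; case: asboolP => [[]|_]; first exact: missed_summable.
  by have [] := I_sum_ideal w0.
have [na [al nz [p pP]]] : exists na : nat * nat, [/\ (na.2 < 2 ^ level k na.1)%N,
    mu (dyadic (level k na.1) na.2 `\` V) <> 0%E &
    exists p, forall i, (p <= i)%N -> A i -> missed k V na.1 na.2 i].
  apply: limsup_sub_missed => // x Ax; apply: ZV; apply: GZ.
  by exists (limsup_along (digits0 k) A) => //; exists A.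
apply: (nAB (pickle na) p) => i pi Ai; rewrite /B pickleK /= asboolT//.
exact: pP.
Qed.

End Measure.

(** * Coding null sets by sequences of intervals *)

Section SummableToNull.
Variable R : realType.
Local Notation half := (half R).
Local Notation mu := (outer_leb R).

(** With a dyadic left endpoint and length [2 * 2^-l], these countably many intervals capture every
    interval of length at most [2^-l]. *)
Definition double_dyadic (al : int * nat) : set R :=
  [set x | al.1%:~R * half al.2 <= x < (al.1%:~R + 2) * half al.2].

Lemma double_dyadic_measure al : mu (double_dyadic al) = (2 * half al.2)%:E.
Proof.
have := half_ge0 R al.2 => h.
by rewrite outer_leb_itv ?mulrDl; [congr (_%:E); lra|lra].
Qed.

Lemma dyadic_scale (x : R) : 0 < x <= 1 -> exists l, x <= half l <= 2 * x.
Proof.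
move=> /andP[x0 x1]; have := half_small x0.
move=> /ex_minnP[[|l] lx lmin]; first by rewrite half0 in lx; lra.
exists l; apply/andP; split; last by rewrite (halfS R l); lra.
by rewrite leNgt; apply/negP => /lmin; rewrite ltnn.
Qed.

Lemma double_dyadic_cover (u v : R) l : v - u <= half l ->
  exists a, `]u, v]%classic `<=` double_dyadic (a, l).
Proof.
move=> uv; have H0 := half_gt0 R l; exists (Num.floor (u / half l)) => x.
rewrite /= in_itv /= => /andP[ux xv]; rewrite /double_dyadic /=.
have /andP[] := floor_itv (u / half l); rewrite intrD ler_pdivlMr// ltr_pdivrMr//.
rewrite !mulrDl mul1r => h1 h2; apply/andP; split; lra.
Qed.

(** Cover [Z] by intervals of total length below [d = e/8]. Adding [d * 2^-i] makes the lengths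
    positive before they are rounded up to powers of two, and the total is at most
    [2 * (d + 2 * d) <= e]. *)
Lemma null_double_dyadic (Z : set R) (e : R) : mu Z = 0%E -> 0 < e <= 1 ->
  exists q : nat -> int * nat, Z `<=` \bigcup_i double_dyadic (q i) /\
    forall K, \sum_(i < K) half (q i).2 <= e.
Proof.
move=> Z0 /andP[e0 e1]; pose d := e / 8.
have d0 : 0 < d by rewrite divr_gt0.
have /ereal_inf_lt[z [/= M [mM ZM] sMz zd]] : (mu Z < d%:E)%E.
  by rewrite Z0 lte_fin.
have lenM i : exists2 len : R, 0 <= len & wlength idfun (M i) = len%:E /\
    forall l, len <= half l -> exists a, M i `<=` double_dyadic (a, l).
  have /ocitvP[->|[[u v] /= uv ->]] := mM i.
    by exists 0 => //; rewrite wlength0; split => // l _; exists 0 => x [].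
  exists (v - u); first by rewrite subr_ge0 ltW.
  by rewrite wlength_itv_bnd ?ltW//; split => // l; exact: double_dyadic_cover.
have [len len0 lenP] : exists2 len : nat -> R, (forall i, 0 <= len i) &
    forall i, wlength idfun (M i) = (len i)%:E /\
      forall l, len i <= half l -> exists a, M i `<=` double_dyadic (a, l).
  have [len lenP] := ex_choice (fun i => let: ex_intro2 x x0 xP := lenM i in
    ex_intro (fun x : R => 0 <= x /\ _) x (conj x0 xP)).
  by exists len => i; have [] := lenP i.
have slen K : \sum_(i < K) len i <= d.
  rewrite -lee_fin; apply: le_trans (ltW zd); rewrite -sMz -sumEFin.
  apply: le_trans (nneseries_lim_ge K _); last first.
    by move=> i _ _; rewrite (lenP i).1 lee_fin.
  by rewrite big_mkord; apply: lee_sum => i _; rewrite (lenP i).1.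
have ex_q i : exists q : int * nat,
    M i `<=` double_dyadic q /\ half q.2 <= 2 * (len i + d * half i).
  have hi := half_gt0 R i; have hi1 := half_le1 R i.
  have dh : 0 < d * half i by rewrite mulr_gt0.
  have dh1 : d * half i <= d by rewrite ler_piMr// ltW.
  have li : len i <= d.
    apply: le_trans (slen i.+1); rewrite big_ord_recr /= lerDr.
    exact: sumr_ge0.
  have d8 : 8 * d = e by rewrite /d; lra.
  have [|l /andP[xl lx]] := @dyadic_scale (len i + d * half i).
    by apply/andP; split; have := len0 i; lra.
  have [|a Ma] := (lenP i).2 l; first lra.
  by exists (a, l).
have [q qP] := ex_choice ex_q.
exists q; split=> [x /ZM[i _ Mx]|K]; first by exists i => //; exact: (qP i).1.
apply: le_trans (_ : \sum_(i < K) 2 * (len i + d * half i) <= _).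
  by apply: ler_sum => i _; case: (qP i).
rewrite -mulr_sumr big_split /= -mulr_sumr.
set S := \sum_(i < K) half i.
have := sum_half R 0 K; rewrite half0 (_ : \sum_(n < K) _ = S); last first.
  by apply: eq_bigr => i _; rewrite mul1r.
have := slen K => h1 h2.
have S0 : 0 <= S by apply: sumr_ge0 => i _; exact: half_ge0.
have : d * S <= d * 2 by rewrite ler_pM2l//; lra.
have : 8 * d = e by rewrite /d; lra.
lra.
Qed.

(** The ignored first component is a stage: it gives intervals chosen at different stages different
    codes, so a point covered at every stage lies in the limsup. *)
Definition code_set (i : nat) : set R :=
  if (unpickle i : option (nat * (int * nat))) is Some (_, al)
  then double_dyadic al else set0.

Definition w_code (i : nat) : R :=
  half (if (unpickle i : option (nat * (int * nat))) is Some (_, (_, l))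
        then l else 0).

Lemma w_code_ge0 i : 0 <= w_code i.
Proof. exact: half_ge0. Qed.

Lemma code_set_measure i : (mu (code_set i) <= (2 * w_code i)%:E)%E.
Proof.
rewrite /code_set /w_code; case: (unpickle _) => [[n [a l]]|].
  by rewrite double_dyadic_measure.
by rewrite outer_measure0 lee_fin mulr_ge0 ?half_ge0.
Qed.

Lemma wsum_bigcup_bounded (w : nat -> R) A (X : nat -> set nat) N M :
  (forall i, 0 <= w i) -> A `<=` \bigcup_n X n ->
  (forall K, \sum_(n < K) wsum w (X n) N <= M) -> wsum w A N <= M.
Proof.
move=> w0 AX XM.
have AX' i : A i -> exists n, X n i by move=> /AX[n _]; exists n.
have [nu nuP] := choice_on 0%N AX'.
apply: le_trans (XM (\max_(i < N) nu i).+1); apply: wsum_bigcup => // i iN Ai.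
by exists (nu i); [rewrite ltnS; exact: bigmax_ord_sup|exact: nuP].
Qed.

Lemma addw_sum_le_addN : mincard_le (addw_wit (I_sum w_code)) (@addN_wit R).
Proof.
apply: mincard_le_image => F [nullF nU].
have ex_q (Z : set R) : F Z -> exists q : nat -> nat -> int * nat,
    forall n, Z `<=` \bigcup_i double_dyadic (q n i) /\
      forall K, \sum_(i < K) half (q n i).2 <= half n.
  move=> /nullF/null_outer_leb Z0.
  have h n : 0 < half n <= 1 by rewrite half_gt0 half_le1.
  exact: (ex_choice (fun n => null_double_dyadic Z0 (h n))).
have [q qP] := choice_on (fun=> fun=> (0, 0%N)) ex_q.
pose X Z n := \bigcup_i [set pickle (n, q Z n i)].
exists (fun Z => \bigcup_n X Z n); split.
  move=> _ [Z FZ <-]; apply: (@I_sum_bigcup _ _ w_code_ge0 _ 1) => // n N.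
  rewrite mul1r.
  apply: (@wsum_bigcup_bounded _ _ (fun i => [set pickle (n, q Z n i)]) _ _ w_code_ge0).
    by [].
  move=> K; apply: le_trans ((qP Z FZ n).2 K); apply: ler_sum => i _.
  apply: le_trans (wsum1 w_code_ge0 _ _) _.
  by rewrite /w_code pickleK; case: (q Z n i).
move=> B IB; apply: contrapT => noA; apply: nU.
apply: (@negligibleS _ _ _ lebesgue_measure
  (\bigcup_l limsup_along code_set (B l))); last first.
  apply: negligible_bigcup => l; apply/null_outer_leb.
  by apply: (limsup_along_null w_code_ge0 _ (IB l) code_set_measure).
move=> x [Z FZ Zx].
have [l ZB] : exists l, \bigcup_n X Z n `<=` B l.
  apply: contrapT => nl; apply: noA; exists (\bigcup_n X Z n); first by exists Z.
  by move=> l ZB; apply: nl; exists l.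
(* Otherwise every stage [n] could be read off from one of the finitely many codes below [m]. *)
exists l => // m; apply: contrapT => nom; apply: infinite_nat.
apply: (@sub_finite_set _ _ ((fun i => if (unpickle i : option (nat * (int * nat)))
   is Some (n, _) then n else 0%N) @` [set i | (i < m)%N])); last first.
  exact/finite_image/finite_II.
move=> n _; have [i _ Zi] := (qP Z FZ n).1 x Zx.
exists (pickle (n, q Z n i)); last by rewrite pickleK.
rewrite /= ltnNge; apply/negP => mi; apply: nom; exists (pickle (n, q Z n i)) => //.
split; first by apply: ZB; exists n => //; exists i.
by rewrite /code_set pickleK.
Qed.

(** * Values for the density and summable ideals *)

Lemma addN_le_addw_1n : mincard_le (@addN_wit R) (addw_wit (I_sum (@w1n R))).
Proof. exact: (@addN_le_addw_sum R (fun i => (trunc_log 2 i.+1).+1)). Qed.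

Lemma addN_le_b : mincard_le (@addN_wit R) b_wit.
Proof.
apply: mincard_le_trans addN_le_addw_1n (addw_le_b_density _ (@I_1n_sub_I_d R)).
by [].
Qed.

Lemma addN_le_addw_I_d : mincard_le (@addN_wit R) (addw_wit (I_d R)).
Proof.
apply: addw_sum_le_addw_I_d addN_le_b _.
apply: addN_le_addw_sum => i; by case: (unpickle i) => [[]|].
Qed.

Lemma density_part (I : set (set nat)) :
  is_ideal I -> Fin `<=` I -> exhaustive I ->
  I_sum (@w1n R) `<=` I -> I `<=` I_d R ->
  mincard_le (@addN_wit R) (addw_wit I) ->
  [/\ mincard_eq (bsigma_wit I) (@addN_wit R),
      mincard_eq (addw_wit I) (@addN_wit R),
      mincard_le (@addN_wit R) b_wit & mincard_eq b_wit (bs_wit I)].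
Proof.
move=> idI FinI exI subI Isub addNI.
have Iadd : mincard_le (addw_wit I) (@addN_wit R).
  apply: mincard_le_trans addw_sum_le_addN.
  exact: (addw_le_addw_sum w_code_ge0 subI Isub).
split; [split|split|exact: addN_le_b|split] => //.
- exact: mincard_le_trans (@bsigma_le_addw _ _) Iadd.
- exact: min_b_addw_le_bsigma addN_le_b addNI.
- exact: b_le_bs_exhaustive.
- exact: (@bs_le_b_density R).
Qed.

Lemma I_d_part :
  [/\ mincard_eq (bsigma_wit (I_d R)) (@addN_wit R),
      mincard_eq (addw_wit (I_d R)) (@addN_wit R),
      mincard_le (@addN_wit R) b_wit & mincard_eq b_wit (bs_wit (I_d R))].
Proof.
apply: density_part => //; [exact: I_d_ideal|exact: I_d_Fin|exact: I_d_exhaustive|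
  exact: I_1n_sub_I_d|exact: addN_le_addw_I_d].
Qed.

Lemma I_1n_part :
  [/\ mincard_eq (bsigma_wit (I_1n R)) (@addN_wit R),
      mincard_eq (addw_wit (I_1n R)) (@addN_wit R),
      mincard_le (@addN_wit R) b_wit & mincard_eq b_wit (bs_wit (I_1n R))].
Proof.
rewrite I_1nP; apply: density_part => //.
- exact: I_sum_ideal (@w1n_ge0 R).
- exact: I_sum_Fin (@w1n_ge0 R).
- exact: I_sum_exhaustive (@w1n_ge0 R).
- exact: I_1n_sub_I_d.
- exact: addN_le_addw_1n.
Qed.

End SummableToNull.

Theorem theorem5p15 (R : realType) :
  (* (1) *)
  [/\ mincard_eq (bsigma_wit Fin) b_wit, mincard_eq (bs_wit Fin) b_wit,
      mincard_finite b_wit & mincard_infinite (addw_wit Fin)] /\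
  (* (2) *)
  [/\ mincard_eq (bsigma_wit Fin_x_empty) b_wit, mincard_eq (bs_wit Fin_x_empty) b_wit,
      mincard_finite b_wit & mincard_infinite (addw_wit Fin_x_empty)] /\
  (* (3) *)
  [/\ mincard_eq (bsigma_wit (I_d R)) (@addN_wit R),
      mincard_eq (addw_wit (I_d R)) (@addN_wit R),
      mincard_le (@addN_wit R) b_wit & mincard_eq b_wit (bs_wit (I_d R))] /\
  (* (4) *)
  [/\ mincard_eq (bsigma_wit (I_1n R)) (@addN_wit R),
      mincard_eq (addw_wit (I_1n R)) (@addN_wit R),
      mincard_le (@addN_wit R) b_wit & mincard_eq b_wit (bs_wit (I_1n R))] /\
  (* (5) *)
  [/\ mincard_eq (bsigma_wit Fin_x_Fin) b_wit, mincard_eq (bs_wit Fin_x_Fin) b_wit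
    & mincard_eq (addw_wit Fin_x_Fin) b_wit] /\
  (* (6) *)
  [/\ mincard_eq (bsigma_wit empty_x_Fin) b_wit, mincard_eq (bs_wit empty_x_Fin) b_wit
    & mincard_eq (addw_wit empty_x_Fin) b_wit] /\
  (* (7) *)
  [/\ mincard_omega1 (bsigma_wit Solecki), mincard_omega1 (bs_wit Solecki)
    & mincard_omega1 (addw_wit Solecki)].
Proof.
have [Fin1 Fin2] := Fin_part.
have [FE1 FE2] := pairs_part Fin_x_empty_ideal Fin_x_empty1
  b_le_bsigma_Fin_x_empty bs_le_b_Fin_x_empty.
have [FF1 FF2] := pairs_part Fin_x_Fin_ideal
  (fun x y => @empty_x_Fin_sub _ (@empty_x_Fin1 x y))
  b_le_bsigma_Fin_x_Fin bs_le_b_Fin_x_Fin.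
have [EF1 EF2] := pairs_part empty_x_Fin_ideal empty_x_Fin1
  b_le_bsigma_empty_x_Fin bs_le_b_empty_x_Fin.
split; first by split => //; [exact: mincard_finite_b|exact: addw_Fin_infinite].
split.
  by split => //; [exact: mincard_finite_b|exact: addw_Fin_x_empty_infinite].
split; first exact: I_d_part.
split; first exact: I_1n_part.
split.
  split => //; split; last exact: mincard_le_trans FF1.2 (@bsigma_le_addw _ _).
  exact: addw_le_b_subgraph empty_x_Fin_sub _.
split; last exact: Solecki_part.
split => //; split; last exact: mincard_le_trans EF1.2 (@bsigma_le_addw _ _).
exact: addw_le_b_subgraph _ empty_x_Fin_sub.
Qed.
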